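(* Let $k$ be a $p$-adic field of odd residual characteristic, $G=\mathrm{SL}_2(k)$ and $K=\mathrm{SL}_2(\mathcal{R})$. Let $\pi$ be an irreducible (smooth, complex) representation of $G$ of depth zero, with central character $\vartheta$. Then every irreducible component of positive depth of the restriction $\mathrm{Res}_K\pi$ is isomorphic to a member of the set $$\{\,\mathcal{S}_t(\vartheta,X_{1,0}),\ \mathcal{S}_t(\vartheta,X_{\varepsilon,0}) \mid t\in\mathbb{Z},\ t\ge 1\,\}.$$
   Context: Notation. $k$ is a $p$-adic field with integer ring $\mathcal{R}$, maximal ideal $\mathcal{P}$, uniformizer $\varpi$, residue field of odd characteristic and cardinality $q$, and valuation $\mathrm{val}$ with $\mathrm{val}(\varpi)=1$. $\varepsilon\in\mathcal{R}^\times$ is a fixed nonsquare, chosen to be $-1$ if $-1$ is not a square. $\Psi$ is a fixed additive character of $k$ that is trivial on $\mathcal{P}$ and nontrivial on $\mathcal{R}$. The center of $G$ is $Z=\{\pm I\}$. For real $r$, $\lceil r\rceil$ is the least integer $\ge r$ and $\lceil r+\rceil$ is the least integer $>r$. Filtrations and depth. For $x\in\mathbb{R}$ (a point of the standard apartment of the Bruhat-Tits building of $G$) and $r>0$, $G_{x,r}$ is the group of matrices in $G$ of the form $\begin{pmatrix}1+\mathcal{P}^{\lceil r\rceil}&\mathcal{P}^{\lceil r-x\rceil}\\ \mathcal{P}^{\lceil r+x\rceil}&1+\mathcal{P}^{\lceil r\rceil}\end{pmatrix}$; for $r\ge0$, $G_{x,r+}$ is defined by the same formula with $\lceil r+\rceil,\lceil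 (r-x)+\rceil,\lceil (r+x)+\rceil$ in place of $\lceil r\rceil,\lceil r-x\rceil,\lceil r+x\rceil$. Every point of the building is $G$-conjugate to a point of this apartment. The depth of an irreducible smooth representation of $G$ is the least $r\ge0$ such that, for some $x$, it has a nonzero $G_{x,r+}$-fixed vector. The depth of an irreducible smooth representation of $K$ is its depth relative to the point $0$: the least $r\ge0$ such that it has a nonzero $G_{0,r+}$-fixed vector. Shalika's ramified representations of $K$. For $u,v\in k$ put $X_{u,v}=\begin{pmatrix}0&u\\ v&0\end{pmatrix}$. Let $\ell>0$, $\ell\in\frac12\mathbb{Z}$, and let $G_{[0,\frac12],\ell}=\bigcap_{x\in[0,\frac12]}G_{x,\ell}$, i.e. the matrices in $G$ of the form $\begin{pmatrix}1+\mathcal{P}^{\lceil \ell\rceil}&\mathcal{P}^{\lceil \ell\rceil}\\ \mathcal{P}^{\lceil \ell+\frac12\rceil}&1+\mathcal{P}^{\lceil \ell\rceil}\end{pmatrix}$. For $X=X_{u,v}$ with $\mathrm{val}(v)>\mathrm{val}(u)=0$ (with $v=0$ allowed), $\Psi_X(z)=\Psi(\varpi^{-2\ell}\mathrm{Tr}(X(z-I)))$ is a character of $G_{[0,\frac12],\ell}$. Let $C(X)$ be the centralizer of $X$ in $K$. If $\varphi$ is a character of $C(X)$ agreeing with $\Psi_X$ on $C(X)\cap G_{[0,\frac12],\ell}$, then $\varphi\Psi_X$ is a character of $C(X)G_{[0,\frac12],\ell}$ and $$\mathcal{S}_{2\ell}(\varphi,X):=\mathrm{Ind}_{C(X)G_{[0,\frac12],\ell}}^{K}\varphi\Psi_X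 ,$$ which is an irreducible representation of $K$ of depth $2\ell$ and degree $\frac12q^{2\ell-1}(q^2-1)$. For $u\in\{1,\varepsilon\}$, $C(X_{u,0})=\left\{\pm\begin{pmatrix}1&b\\ 0&1\end{pmatrix}: b\in\mathcal{R}\right\}$; a character $\vartheta$ of $Z$ is viewed as a character of $C(X_{u,0})$ by letting it be trivial on the upper triangular unipotent matrices, and this gives the meaning of $\mathcal{S}_t(\vartheta,X_{u,0})$. *)

(* Defs.v *)
From HB Require Import structures.
From mathcomp Require Import all_boot all_order all_algebra.
From mathcomp Require Import complex.
From mathcomp Require Import boolp classical_sets functions set_interval reals.

Set Implicit Arguments.
Unset Strict Implicit.
Unset Printing Implicit Defensive.

Import Order.TTheory GRing.Theory Num.Theory.
Local Open Scope classical_set_scope.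
Local Open Scope ring_scope.
Local Open Scope complex_scope.

(* {y | v y >= n}, with the convention v 0 = +oo: the value v 0 is never used. *)
Definition fracideal (F : fieldType) (v : F -> int) (n : int) : {pred F} :=
  [pred y | (y == 0) || (n <= v y)].

(* A field of characteristic 0, complete for a normalized discrete valuation
   with finite residue field. The residue field is given together with the
   reduction map: a surjective ring morphism on the valuation ring, with kernel
   the maximal ideal (its values outside the valuation ring are irrelevant). *)
Record padicField := PadicField {
  padic_sort :> fieldType;
  pval : padic_sort -> int;
  pvalM : forall x y, x != 0 -> y != 0 -> pval (x * y) = pval x + pval y;
  pvalD : forall x y, x != 0 -> y != 0 -> x + y != 0 ->
    Num.min (pval x) (pval y) <= pval (x + y);
  pval_normalized : exists2 w, w != 0 & pval w = 1;
  padic_complete : forall u : nat -> padic_sort,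
    (forall n : int, exists N : nat, forall i j : nat, (N <= i)%N -> (N <= j)%N ->
       u i - u j \in fracideal pval n) ->
    exists l, forall n : int, exists N : nat, forall i : nat, (N <= i)%N ->
       u i - l \in fracideal pval n;
  padic_pchar0 : [pchar padic_sort] =i pred0;
  residue_field : finFieldType;
  reduction : padic_sort -> residue_field;
  reduction1 : reduction 1 = 1;
  reductionD : {in fracideal pval 0 &, {morph reduction : x y / x + y}};
  reductionM : {in fracideal pval 0 &, {morph reduction : x y / x * y}};
  reduction_surj : forall a, exists2 x, x \in fracideal pval 0 & reduction x = a;
  reduction_ker : {in fracideal pval 0, forall x,
    (reduction x == 0) = (x \in fracideal pval 1)}
}.

Definition Pideal (k : padicField) (n : int) : {pred k} := fracideal (@pval k) n.
Arguments Pideal : clear implicits.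

Section PidealTheory.
Variable k : padicField.
Implicit Types (x y : k) (n m : int).

Lemma pval1 : pval (1 : k) = 0.
Proof.
have /(congr1 (fun n => n - pval (1 : k))) := @pvalM k 1 1 (oner_neq0 _) (oner_neq0 _).
by rewrite mulr1 subrr addrK => <-.
Qed.

Lemma pvalN1 : pval (-1 : k) = 0.
Proof.
have N1 : (-1 : k) != 0 by rewrite oppr_eq0 oner_neq0.
have := pvalM N1 N1; rewrite mulrNN mulr1 pval1 -mulr2n => /esym/eqP.
by rewrite mulrn_eq0 /= => /eqP.
Qed.

Lemma Pideal0 n : (0 : k) \in Pideal k n.
Proof. by rewrite inE eqxx. Qed.

Lemma Pideal_one : (1 : k) \in Pideal k 0.
Proof. by rewrite inE pval1 lexx orbT. Qed.

Lemma PidealM n m x y :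
  x \in Pideal k n -> y \in Pideal k m -> x * y \in Pideal k (n + m).
Proof.
rewrite !inE; have [->|x0] := eqVneq x 0; first by rewrite mul0r eqxx.
have [->|y0] := eqVneq y 0; first by rewrite mulr0 eqxx.
by move=> /= xn ym; rewrite pvalM// lerD ?orbT.
Qed.

Lemma PidealD n x y :
  x \in Pideal k n -> y \in Pideal k n -> x + y \in Pideal k n.
Proof.
rewrite !inE; have [->|x0] := eqVneq x 0; first by rewrite add0r.
have [->|y0] := eqVneq y 0; first by rewrite addr0 (negPf x0).
have [//|xy0 /= xn yn] := eqVneq (x + y) 0.
by rewrite (le_trans _ (pvalD x0 y0 xy0))// le_min xn.
Qed.

Lemma PidealN n x : x \in Pideal k n -> - x \in Pideal k n.
Proof.
move=> xn; rewrite -mulN1r -[n]add0r; apply: PidealM xn.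
by rewrite inE pvalN1 lexx orbT.
Qed.

End PidealTheory.

Definition uniformizer (k : padicField) (w : k) := w != 0 /\ pval w = 1.

Definition is_square (k : padicField) (x : k) := exists y : k, x = y ^+ 2.

Definition standard_nonsquare (k : padicField) (eps : k) :=
  [/\ eps != 0, pval eps = 0, ~ is_square eps &
      ~ is_square (-1 : k) -> eps = -1].

(* Continuity and unitarity follow: every x in k has a multiple p^m x in P. *)
Definition depth_zero_character (k : padicField) (C : fieldType) (Psi : k -> C) :=
  [/\ forall x y, Psi (x + y) = Psi x * Psi y,
      {in Pideal k 1, forall x, Psi x = 1} &
      exists2 x, x \in Pideal k 0 & Psi x != 1].

Section SL2.
Variable F : fieldType.

Definition SL2 := {A : 'M[F]_2 | \det A == 1}.
HB.instance Definition _ := SubChoice.on SL2.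

Lemma SL2_det (g : SL2) : \det (\val g) = 1. Proof. exact/eqP/(valP g). Qed.

Lemma SL2_unit (g : SL2) : \val g \in unitmx.
Proof. by rewrite unitmxE SL2_det unitr1. Qed.

Fact SL2_one_subproof : \det (1%:M : 'M[F]_2) == 1. Proof. by rewrite det1. Qed.
Fact SL2_mul_subproof (g h : SL2) : \det (\val g *m \val h) == 1.
Proof. by rewrite det_mulmx !SL2_det mulr1. Qed.
Fact SL2_inv_subproof (g : SL2) : \det (invmx (\val g)) == 1.
Proof. by rewrite det_inv SL2_det invr1. Qed.

Definition SL2_one : SL2 := Sub 1%:M SL2_one_subproof.
Definition SL2_mul g h : SL2 := Sub (\val g *m \val h) (SL2_mul_subproof g h).
Definition SL2_inv g : SL2 := Sub (invmx (\val g)) (SL2_inv_subproof g).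

Fact SL2_mulA : associative SL2_mul.
Proof. by move=> x y z; apply/val_inj; rewrite /= mulmxA. Qed.
Fact SL2_mul1g : left_id SL2_one SL2_mul.
Proof. by move=> x; apply/val_inj; rewrite /= mul1mx. Qed.
Fact SL2_mulg1 : right_id SL2_one SL2_mul.
Proof. by move=> x; apply/val_inj; rewrite /= mulmx1. Qed.
Fact SL2_mulVg : left_inverse SL2_one SL2_inv SL2_mul.
Proof. by move=> x; apply/val_inj; rewrite /= mulVmx ?SL2_unit. Qed.
Fact SL2_mulgV : right_inverse SL2_one SL2_inv SL2_mul.
Proof. by move=> x; apply/val_inj; rewrite /= mulmxV ?SL2_unit. Qed.

HB.instance Definition _ :=
  isGroup.Build SL2 SL2_mulA SL2_mul1g SL2_mulg1 SL2_mulVg SL2_mulgV.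

End SL2.

Section MaximalCompact.
Variable k : padicField.

Definition integral_SL2 : {pred SL2 k} :=
  [pred g : SL2 k | [forall i, forall j, \val g i j \in Pideal k 0]].

Lemma integral_SL2P (g : SL2 k) :
  reflect (forall i j, \val g i j \in Pideal k 0) (g \in integral_SL2).
Proof.
apply: (iffP forallP) => [H i j|H i]; first by have /forallP := H i; exact.
by apply/forallP => j; exact: H.
Qed.

Fact integral_SL2_closed : group_closed integral_SL2.
Proof.
have R0 (x y : k) : x \in Pideal k 0 -> y \in Pideal k 0 -> x * y \in Pideal k 0.
  by rewrite -{3}[0]addr0; exact: PidealM.
split; first by apply/integral_SL2P => i j; rewrite mxE; case: eqP;
  rewrite ?Pideal_one ?Pideal0.
move=> g h /integral_SL2P gR /integral_SL2P hR; apply/integral_SL2P => i j.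
rewrite mxE; apply: (big_ind (fun x => x \in Pideal k 0)) => [|x y|l _];
  [exact: Pideal0|exact: PidealD|].
apply: (R0) => //=; rewrite /invmx SL2_unit SL2_det invr1 scale1r mxE /cofactor.
apply: (R0); last by rewrite det_mx11 !mxE.
by elim: (_ + _)%N => [|n IHn]; rewrite ?Pideal_one// exprS; apply: (R0) => //;
  exact/PidealN/Pideal_one.
Qed.

(* K = SL_2 of the ring of integers, as a subgroup of SL_2(k) *)
Definition SL2R := {g : SL2 k | g \in integral_SL2}.
HB.instance Definition _ := SubChoice.on SL2R.
HB.instance Definition _ :=
  SubChoice_isSubGroup.Build (SL2 k) integral_SL2 SL2R integral_SL2_closed.

End MaximalCompact.

Section Representations.
Variable C : fieldType.

Record representation (gT : groupType) (V : lmodType C) := Repr {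
  repr_fun :> gT -> {linear V -> V};
  repr1 : forall v, repr_fun 1%g v = v;
  reprM : forall g h v, repr_fun (g * h)%g v = repr_fun g (repr_fun h v)
}.

Definition irreducible (gT : groupType) (V : lmodType C) (rho : representation gT V) :=
  (exists v : V, v != 0) /\
  forall S : {pred V}, submod_closed S ->
    (forall g, {in S, forall v, rho g v \in S}) ->
    (forall v, v \in S -> v = 0) \/ (forall v, v \in S).

Definition intertwines (gT : groupType) (V W : lmodType C)
    (rho : representation gT V) (sigma : representation gT W) (f : {linear V -> W}) :=
  forall g v, f (rho g v) = sigma g (f v).

Definition isomorphic (gT : groupType) (V W : lmodType C)
    (rho : representation gT V) (sigma : representation gT W) :=
  exists2 f : {linear V -> W}, bijective f & intertwines rho sigma f.

Definition subrepresentation (gT : groupType) (V W : lmodType C)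
    (rho : representation gT V) (sigma : representation gT W) :=
  exists2 f : {linear V -> W}, injective f & intertwines rho sigma f.

Definition fixed_vector (gT : groupType) (V : lmodType C) (rho : representation gT V)
    (U : set gT) (v : V) := forall g, U g -> rho g v = v.

Definition is_character (gT : groupType) (H : set gT) (chi : gT -> C) :=
  chi 1%g = 1 /\
  forall g h, H g -> H h -> chi (g * h)%g = chi g * chi h.

Definition prod_set (gT : groupType) (A B : set gT) : set gT :=
  [set (a * b)%g | a in A & b in B].

(* The function ab |-> phi(a) psi(b) on AB. It is meant for characters phi of A
   and psi of B for which phi(a) psi(b) depends on ab only, so that the choice
   made by xget is immaterial on AB; the value outside AB is irrelevant. *)
Definition prod_char (gT : groupType) (A B : set gT) (phi psi : gT -> C) (g : gT) : C :=
  xget 0 [set y | exists a b,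
    [/\ A a, B b, g = (a * b)%g & y = phi a * psi b]].

Section Restriction.
Variables (gT : groupType) (P : pred gT) (hT : subGroupType P).
Variables (V : lmodType C) (rho : representation gT V).

Fact res1 v : rho (\val (1%g : hT)) v = v.
Proof. by rewrite val1 repr1. Qed.
Fact resM (g h : hT) v : rho (\val (g * h)%g) v = rho (\val g) (rho (\val h) v).
Proof. by rewrite valM reprM. Qed.

Definition restriction : representation hT V := Repr res1 resM.

End Restriction.

(* Functions f with f(hg) = chi(h) f(g) for h in H, under right translation.
   Only used for H open and of finite index and chi smooth, in which case all
   such functions are locally constant. *)
Section Induction.
Variables (gT : groupType) (H : set gT) (chi : gT -> C).

Definition ind_pred : {pred gT -> C^o} :=
  [pred f | `[< forall h g, H h -> f (h * g)%g = chi h * f g >]].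

Fact ind_submod_closed : submod_closed ind_pred.
Proof.
split; first by apply/asboolP => h g _; rewrite mulr0.
move=> a f1 f2 /asboolP f1P /asboolP f2P; apply/asboolP => h g Hh.
rewrite !fctE /= f1P // f2P // /GRing.scale /= mulrDr.
by rewrite mulrCA.
Qed.
HB.instance Definition _ :=
  GRing.isSubmodClosed.Build _ _ ind_pred ind_submod_closed.

Definition ind_space := {f : gT -> C^o | f \in ind_pred}.
HB.instance Definition _ := SubChoice.on ind_space.
HB.instance Definition _ := [SubChoice_isSubLmodule of ind_space by <:].

Fact ind_act_subproof (x : gT) (f : ind_space) :
  (fun g => \val f (g * x)%g) \in ind_pred.
Proof.
by apply/asboolP => h g Hh; rewrite -mulgA; move/asboolP: (valP f); exact.
Qed.

Definition ind_act (x : gT) (f : ind_space) : ind_space :=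
  Sub (fun g => \val f (g * x)%g) (ind_act_subproof x f).

Fact ind_act_linear x : linear (ind_act x).
Proof. by move=> a f1 f2; apply/val_inj. Qed.
HB.instance Definition _ x :=
  GRing.isLinear.Build C ind_space ind_space _ (ind_act x) (ind_act_linear x).

Fact ind1 (f : ind_space) : ind_act 1%g f = f.
Proof. by apply/val_inj/funext => g /=; rewrite mulg1. Qed.
Fact indM (x y : gT) (f : ind_space) :
  ind_act (x * y)%g f = ind_act x (ind_act y f).
Proof. by apply/val_inj/funext => g /=; rewrite mulgA. Qed.

Definition induced : representation gT ind_space :=
  @Repr gT ind_space (fun x => ind_act x : {linear ind_space -> ind_space}) ind1 indM.

End Induction.

End Representations.

Section Filtrations.
Variables (R : realType) (k : padicField).

Definition congr_set (a b c : int) : set (SL2 k) := [set g : SL2 k |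
  [/\ \val g 0 0 - 1 \in Pideal k a, \val g 0 1 \in Pideal k b,
      \val g 1 0 \in Pideal k c & \val g 1 1 - 1 \in Pideal k a]].

(* the least integer > r *)
Definition ceil_plus (r : R) : int := Num.floor r + 1.

(* G_{x,r}, meant for r > 0 *)
Definition Gxr (x r : R) : set (SL2 k) :=
  congr_set (Num.ceil r) (Num.ceil (r - x)) (Num.ceil (r + x)).

(* G_{x,r+}, meant for r >= 0 *)
Definition Gxrp (x r : R) : set (SL2 k) :=
  congr_set (ceil_plus r) (ceil_plus (r - x)) (ceil_plus (r + x)).

(* G_{[0,1/2],r} *)
Definition Gseg (r : R) : set (SL2 k) :=
  \bigcap_(x in `[0, 2^-1]%classic) Gxr x r.

(* The G_{0,r}, r > 0, are a basis of neighbourhoods of the identity. *)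
Definition smooth (V : lmodType R[i]) (pi : representation (SL2 k) V) :=
  forall v, exists2 r : R, 0 < r & fixed_vector pi (Gxr 0 r) v.

Definition least (A : set R) (r : R) := A r /\ lbound A r.

(* Every point of the building is conjugate to some x in the standard apartment,
   so it suffices to let x range over the reals. *)
Definition has_depth (V : lmodType R[i]) (pi : representation (SL2 k) V) : R -> Prop :=
  least [set r | 0 <= r /\
    exists x : R, exists2 v, v != 0 & fixed_vector pi (Gxrp x r) v].

(* depth relative to the point 0 *)
Definition has_depthK (V : lmodType R[i]) (sigma : representation (SL2R k) V) :
    R -> Prop :=
  least [set r | 0 <= r /\
    exists2 v, v != 0 & fixed_vector sigma (\val @^-1` Gxrp 0 r) v].

Definition SL2_center : set (SL2 k) :=
  [set z : SL2 k | \val z = 1%:M \/ \val z = - 1%:M].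

Definition central_character (V : lmodType R[i]) (pi : representation (SL2 k) V)
    (theta : SL2 k -> R[i]) :=
  is_character SL2_center theta /\
  forall z v, SL2_center z -> pi z v = theta z *: v.

End Filtrations.

Arguments Gxr {R} k x r.
Arguments Gxrp {R} k x r.
Arguments Gseg {R} k r.
Arguments SL2_center : clear implicits.

Section Shalika.
Variables (R : realType) (k : padicField) (w : k) (Psi : k -> R[i]).

Definition antidiag (u v : k) : 'M[k]_2 :=
  \matrix_(i, j) if (i == 0) && (j == 1) then u
                 else if (i == 1) && (j == 0) then v else 0.

(* Psi_X on G_{[0,1/2],t/2} *)
Definition PsiX (t : int) (X : 'M[k]_2) (g : SL2 k) : R[i] :=
  Psi (w ^ (- t) * \tr (X *m (\val g - 1%:M))).

(* C(X), the centralizer of X in K *)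
Definition centralizerK (X : 'M[k]_2) : set (SL2 k) :=
  [set g : SL2 k | g \in @integral_SL2 k /\ \val g *m X = X *m \val g].

Section Induced.
Variables (t : int) (phi : SL2 k -> R[i]) (X : 'M[k]_2).
Let J : set (SL2 k) := Gseg k (t%:~R / 2 : R).

(* C(X) G_{[0,1/2],t/2} *)
Definition shalika_group : set (SL2 k) := prod_set (centralizerK X) J.

(* phi Psi_X *)
Definition shalika_char : SL2 k -> R[i] :=
  prod_char (centralizerK X) J phi (PsiX t X).

(* S_t(phi, X) *)
Definition shalika :=
  induced (\val @^-1` shalika_group : set (SL2R k)) (shalika_char \o \val).

End Induced.

Definition upper_unipotent : set (SL2 k) := [set n : SL2 k | exists2 b : k,
  b \in Pideal k 0 & \val n = 1%:M + antidiag b 0].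

(* theta viewed as a character of C(X_{u,0}) *)
Definition unip_ext (theta : SL2 k -> R[i]) : SL2 k -> R[i] :=
  prod_char (SL2_center k) upper_unipotent theta (fun=> 1).

End Shalika.

(* Main.v *)
From HB Require Import structures.
Require Import Defs.
From mathcomp Require Import all_boot all_order all_algebra.
From mathcomp Require Import fingroup cyclic.
From mathcomp Require Import complex.
From mathcomp Require Import boolp classical_sets functions reals.
From mathcomp Require Import ring lra zify.

(** A depth-zero [pi] is generated by a vector fixed by some G_{x,0+}, and by elementary
    divisors every G-conjugate of G_{x,0+} contains a K-conjugate of either the first
    congruence subgroup of K or the group [Iw 1 m] of matrices of K with diagonal in 1 + P
    and lower left entry in P^m, for some m. Averaging a retraction of [pi] onto [sigma] over K
    transports such a fixed vector to [sigma]; positive depth excludes the first case.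
    For the least m, put t = m - 1: decomposing under P^t / P^(t+1) gives a vector on
    which [Iw 1 t] acts by the character Psi(w^-t u g_21) with u a unit, and the diagonal
    torus and Hensel's lemma reduce to u = 1 or u = eps.
    The groups [Iw al n] with 1 <= al <= n and al + n = t + 1 all carry this character, and
    in each of them, up to sign, lie all the elements of K that intertwine it. This lets
    one pass from [Iw 1 t] to the group J of Shalika's construction and shows that the
    matrix coefficients of the resulting vector fill the induced representation. *)

Set Implicit Arguments.
Unset Strict Implicit.
Unset Printing Implicit Defensive.

Import Order.TTheory GRing.Theory Num.Theory.
Local Open Scope classical_set_scope.
Local Open Scope ring_scope.
Local Open Scope complex_scope.

(** The obstacle is that [pi] may be infinite dimensional and [sigma] is only embedded in it. A
    retraction therefore comes from Zorn's lemma and has no smoothness: its averages over K /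
    [Kcong i] are equivariant only on vectors fixed by [Kcong i], so i has to grow with the vector.
    On the side of [sigma], irreducibility makes some [Kcong N] act trivially, and every average
    over K becomes a finite sum.

    The groups [Iw al n] put no condition on the upper right entry because the centralizer of the
    nilpotent matrix X contains all integral upper unipotents. At the balanced choice al =
    ceil(t/2), n = floor(t/2) + 1, the group of all ± [Iw al n] is exactly C(X) J. An eigenvector is
    easiest to find at the other extreme, al = 1 and n = t, where [Iw 1 t] / [Iw 1 (t + 1)] is one
    copy of the residue field. Projecting it to the balanced level cannot kill it: a matrix
    coefficient supported on ± [Iw 1 t] sees only equal nonzero terms. *)

(** * Linear retractions and functionals *)

Section LinearRetraction.
Variables (C : fieldType) (V W : lmodType C) (f : {linear W -> V}).

Let closed (A : set V) :=
  (forall a x y, A x -> A y -> A (a *: x + y)) /\ (forall w, A (f w) -> f w = 0).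

Lemma exists_complement : exists A : set V,
  [/\ A 0, closed A & forall x, exists w, A (x - f w)].
Proof.
have [F Ftot|A [[Alin Af] Amax]] := @Zorn_bigcup V closed.
  move=> tot; split.
    move=> a x y [X FX Xx] [Y FY Yy].
    have [XY|YX] := tot _ _ FX FY.
      by exists Y => //; have [+ _] := Ftot _ FY; apply => //; exact: XY.
    by exists X => //; have [+ _] := Ftot _ FX; apply => //; exact: YX.
  by move=> w [X FX Xw]; have [_ +] := Ftot _ FX; apply.
(* The empty set is [closed] too, being the union of the empty chain; maximality against the zero
   subspace rules it out. *)
have A0 : A 0.
  apply: contrapT => nA0.
  have A_empty x : ~ A x.
    by move=> Ax; apply: nA0; rewrite -(addNr x) -scaleN1r; exact: Alin.
  apply: (Amax [set 0]).
    by split=> [x /A_empty//|/(_ 0 erefl)].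
  by split=> [a x y -> ->|w ->//]; rewrite scaler0 addr0.
exists A; split=> // x; apply: contrapT => /forallNP xN.
(* [B] is [A] plus the line through [x]; it still meets the image of [f] only in 0, because [x] lies
   outside [A] plus that image. *)
pose B : set V := [set y | exists c, A (y - c *: x)].
apply: (Amax B); first split.
- by move=> y Ay; exists 0; rewrite scale0r subr0.
- move=> BA; apply: (xN 0); rewrite linear0 subr0; apply: BA.
  by exists 1; rewrite scale1r subrr.
- split=> [a y z [c Ac] [d Ad]|w [c Ac]].
    exists (a * c + d); have := Alin a _ _ Ac Ad.
    by rewrite scalerDl scalerBr scalerA opprD addrACA.
  have [c0|c0] := eqVneq c 0.
    by apply: Af; move: Ac; rewrite c0 scale0r subr0.
  exfalso; apply: (xN (c^-1 *: w)).
  have := Alin (- c^-1) _ _ Ac A0; rewrite addr0 scalerBr scalerA mulNr mulVf//.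
  by rewrite scaleN1r opprK linearZ/= scaleNr addrC.
Qed.

Lemma linear_retraction : injective f ->
  exists g : {linear V -> W}, cancel f g.
Proof.
move=> finj; have [A [A0 [Alin Af] Af_ex]] := exists_complement.
pose g x := sval (cid (Af_ex x)).
have gP x : A (x - f (g x)) by rewrite /g; case: cid.
have g_uniq x w : A (x - f w) -> g x = w.
  move=> Aw; apply: finj; apply/eqP; rewrite -subr_eq0 -linearB; apply/eqP/Af.
  have := Alin (-1) _ _ (gP x) Aw.
  by rewrite scaleN1r opprB addrA subrK linearB.
have glin : linear g.
  move=> a x y; apply: g_uniq; have := Alin a _ _ (gP x) (gP y).
  by rewrite linearP scalerBr opprD addrACA.
pose gL := GRing.isLinear.Build C V W _ g glin.
pose G : {linear V -> W} := HB.pack g gL.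
by exists G => w; apply: g_uniq; rewrite subrr.
Qed.

End LinearRetraction.

Lemma linear_functional (C : fieldType) (W : lmodType C) (w : W) : w != 0 ->
  exists l : {linear W -> C^o}, l w = 1.
Proof.
move=> w0; pose f (c : C^o) := c *: w.
have flin : linear f by move=> a x y; rewrite /f scalerDl scalerA.
pose F : {linear C^o -> W} := HB.pack f (GRing.isLinear.Build C C^o W _ f flin).
have [x y /eqP|l lK] := @linear_retraction C W C^o F.
  by rewrite -subr_eq0 -scalerBl scaler_eq0 (negPf w0) orbF subr_eq0 => /eqP.
by exists l; have := lK 1; rewrite /= /f scale1r.
Qed.

(** * Finite families of coset representatives *)

Section CosetReps.
Variable gT : groupType.
Implicit Types (H N : set gT) (g h : gT).

Definition is_subgroup H :=
  [/\ H 1%g, forall g h, H g -> H h -> H (g * h)%g & forall g, H g -> H (g^-1)%g].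

Definition coset_reps H N (n : nat) (s : 'I_n -> gT) :=
  [/\ forall i, H (s i), injective s, forall i j, N ((s i)^-1 * s j)%g -> i = j &
      forall h, H h -> exists i, N ((s i)^-1 * h)%g].

(** Elements of [H] in distinct cosets of [N] have distinct values under [c], which bounds the
    length of such a family by [#|T|]. A longest family meets every coset, since a missed one could
    be added. *)
Lemma coset_reps_exist H N (T : finType) (c : gT -> T) : is_subgroup N ->
  (forall g h, H g -> H h -> c g = c h -> N (g^-1 * h)%g) ->
  exists n (s : 'I_n -> gT), coset_reps H N s.
Proof.
move=> [N1 NM NV] cP.
pose P n := `[< exists s : 'I_n -> gT, (forall i, H (s i)) /\
  (forall i j, N ((s i)^-1 * s j)%g -> i = j) >].
have P0 : exists n, P n by exists 0%N; apply/asboolP; exists (fun=> 1%g); split; case.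
have Pb n : P n -> (n <= #|T|)%N.
  move=> /asboolP[s [sH sN]]; rewrite -(card_ord n).
  apply: (leq_card (c \o s)) => i j /= /cP cij; exact/sN/cij.
have [n /asboolP[s [sH sN]] nmax] := ex_maxnP P0 Pb.
exists n, s; split => //.
  by move=> i j sij; apply: sN; rewrite sij mulVg.
move=> h Hh; apply: contrapT => /forallNP hN.
suff : (n.+1 <= n)%N by rewrite ltnn.
apply: nmax; apply/asboolP.
exists (fun i => if unlift ord0 i is Some j then s j else h); split.
  by move=> i; case: unlift.
move=> i j; case: unliftP => [i'|] ->; case: unliftP => [j'|] ->//.
- by move=> /sN ->.
- by move=> /hN.
- by move=> /NV; rewrite invgM invgK => /hN.
Qed.

(** Left translation by [h] permutes the cosets x N, on which [F] is constant. This replaces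
    invariance of Haar measure in all averages below. *)
Lemma sum_coset_reps (U : zmodType) H N n (s : 'I_n -> gT) (F : gT -> U) h :
  is_subgroup H -> is_subgroup N -> coset_reps H N s ->
  (forall x y, H x -> N y -> F (x * y)%g = F x) ->
  H h -> \sum_i F (h * s i)%g = \sum_i F (s i).
Proof.
move=> [H1 HM HV] [N1 NM NV] [sH sI sN sE] FN Hh.
pose r i := sval (cid (sE (h * s i)%g (HM _ _ Hh (sH i)))).
have rP i : N ((s (r i))^-1 * (h * s i))%g by rewrite /r; case: cid.
have rI : injective r.
  move=> i j rij; apply: sN.
  have := NM _ _ (NV _ (rP i)) (rP j).
  by rewrite rij !invgM invgK !mulgA mulgK mulgVK.
rewrite [RHS](reindex_inj rI)/=; apply: eq_bigr => i _.
rewrite -(FN (s (r i)) ((s (r i))^-1 * (h * s i))%g)//.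
by rewrite mulgA mulgV mul1g.
Qed.

(** The representative of the trivial coset lies in [N]. Such counts occur as scalar factors that
    must not vanish. *)
Lemma count_coset_reps_gt0 H N n (s : 'I_n -> gT) (P : set gT) :
  H 1%g -> is_subgroup N -> coset_reps H N s -> N `<=` P ->
  (0 < #|[pred i | `[< P (s i) >]]|)%N.
Proof.
move=> H1 [N1 NM NV] [sH sI sN sE] NP.
have [i si] := sE 1%g H1; apply/card_gt0P; exists i.
by apply/asboolP/NP; rewrite -[s i]invgK; apply: NV; rewrite -[(s i)^-1%g]mulg1.
Qed.

End CosetReps.

(** * Transfer of fixed vectors from [pi] to [sigma] *)

Section RepresentationTheory.
Variable C : numFieldType.

Definition normal_subset (gT : groupType) (N : set gT) :=
  forall g h, N h -> N (g * h * g^-1)%g.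

Lemma repr_invK (gT : groupType) (V : lmodType C) (rho : representation gT V) g :
  cancel (rho g) (rho g^-1%g).
Proof. by move=> v; rewrite -reprM mulVg repr1. Qed.

Lemma repr_invKV (gT : groupType) (V : lmodType C) (rho : representation gT V) g :
  cancel (rho g^-1%g) (rho g).
Proof. by move=> v; rewrite -reprM mulgV repr1. Qed.

(** Vectors fixed by a normal subset form a subrepresentation. Applied to congruence subgroups, this
    makes [sigma] factor through a finite quotient of K. *)
Lemma irreducible_normal_fixed (gT : groupType) (V : lmodType C)
    (rho : representation gT V) (N : set gT) (v : V) :
  irreducible rho -> normal_subset N -> v != 0 -> fixed_vector rho N v ->
  forall w, fixed_vector rho N w.
Proof.
move=> [_ irr] Nn v0 vN.
pose S : {pred V} := [pred w | `[< fixed_vector rho N w >]].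
have [||S0 w|SV w] := irr S.
- split=> [|a x y /asboolP xN /asboolP yN]; apply/asboolP=> g Ng.
    by rewrite linear0.
  by rewrite linearP xN ?yN.
- move=> g w /asboolP wN; apply/asboolP => h Nh.
  have /wN hw := Nn g^-1%g h Nh.
  by rewrite -[in RHS]hw -!reprM invgK !mulgA mulgV mul1g.
- have /S0 ve : v \in S by apply/asboolP.
  by move: v0; rewrite ve eqxx.
- by have /asboolP := SV w.
Qed.

Section Transfer.
Variables (gT : groupType) (P : pred gT) (hT : subGroupType P).
Variables (V W : lmodType C) (pi : representation gT V) (sigma : representation hT W).
Variables (f : {linear W -> V}).
Hypotheses (f_inj : injective f) (f_int : intertwines sigma (restriction hT pi) f).
Variable N : nat -> set hT.
Hypotheses (N_subgroup : forall i, is_subgroup (N i))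
  (N_normal : forall i, normal_subset (N i))
  (N_mono : forall i j, (i <= j)%N -> N j `<=` N i)
  (N_finite_index : forall i, exists n (s : 'I_n -> hT), coset_reps setT (N i) s)
  (N_smooth : forall v, exists i, fixed_vector (restriction hT pi) (N i) v).
Hypotheses (pi_irr : irreducible pi) (sigma_irr : irreducible sigma).

(* The nonzero vector of [W] is the image of [pi g v0], for a suitable [g], under a
   linear retraction of [f] averaged over [hT / N i]. *)
Lemma transfer_fixed_vector (v0 : V) : v0 != 0 ->
  exists g, exists2 w, w != 0 & forall h : hT,
    pi (\val h) (pi g v0) = pi g v0 -> sigma h w = w.
Proof.
move=> v0_neq0; apply: contrapT => noW.
have [q qK] := linear_retraction f_inj.
have repsP i := cid (N_finite_index i).
pose n i := sval (repsP i); pose s i := sval (cid (svalP (repsP i))).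
have sP i : coset_reps setT (N i) (s i) := svalP (cid (svalP (repsP i))).
(* The unnormalized average of the retraction [q] over hT / [N i]. *)
pose Q i x := \sum_j sigma (s i j) (q (pi (\val (s i j)^-1%g) x)).
have subT : is_subgroup [set: hT] by [].
have [[w0 w0_neq0] _] := sigma_irr.
have [i0 i0W] : exists i0, forall i, (i0 <= i)%N -> forall w, fixed_vector sigma (N i) w.
  have [i0 i0P] := N_smooth (f w0); exists i0 => i i0i.
  apply: (irreducible_normal_fixed sigma_irr (@N_normal i) w0_neq0).
  by move=> h /(N_mono i0i) Nh; apply: f_inj; rewrite f_int; exact: i0P.
have Qequiv i x h : (i0 <= i)%N -> fixed_vector (restriction hT pi) (N i) x ->
    Q i (pi (\val h) x) = sigma h (Q i x).
  move=> i0i xN; rewrite /Q linear_sum/=.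
  pose F k := sigma h (sigma k (q (pi (\val k^-1%g) x))).
  rewrite -(@sum_coset_reps _ _ setT (N i) _ _ F h^-1%g subT _ (sP i))//.
    apply: eq_bigr => j _; rewrite /F -[RHS]reprM mulgA mulgV mul1g.
    by rewrite -reprM -valM invgM invgK.
  move=> k m _ Nm; rewrite /F reprM; congr (sigma h (sigma k _)).
  rewrite (i0W i)// invgM; congr (q _).
  have [_ _ NV] := N_subgroup i.
  have := xN _ (N_normal k (NV _ Nm)); rewrite /= => xk.
  by rewrite -[in RHS]xk -reprM -valM !mulgA mulVg mul1g.
(* No single [i] serves all vectors, so [S] asks for vanishing at all large [i]; quantifying over
   [g] makes it stable under the whole group. *)
pose S : {pred V} := [pred x |
  `[< forall g, exists i1, forall i, (i1 <= i)%N -> Q i (pi g x) = 0 >]].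
have [_ irr] := pi_irr.
have [||S0|SV] := irr S.
- split=> [|a x y /asboolP xS /asboolP yS]; apply/asboolP=> g.
    exists 0%N => i _; rewrite linear0 /Q big1// => j _.
    by rewrite !linear0.
  have [[i1 h1] [i2 h2]] := (xS g, yS g); exists (maxn i1 i2) => i.
  rewrite geq_max => /andP[/h1 e1 /h2 e2].
  transitivity (a *: Q i (pi g x) + Q i (pi g y)).
    rewrite /Q scaler_sumr -big_split; apply: eq_bigr => j _.
    by rewrite !linearP.
  by rewrite e1 e2 scaler0 addr0.
- move=> g x /asboolP xS; apply/asboolP=> h.
  by have [i1 h1] := xS (h * g)%g; exists i1 => i /h1; rewrite reprM.
- suff /S0 v00 : v0 \in S by rewrite v00 eqxx in v0_neq0.
  apply/asboolP => g; have [i1 i1P] := N_smooth (pi g v0).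
  exists (maxn i0 i1) => i; rewrite geq_max => /andP[i0i i1i].
  apply: contrapT => /eqP Q0; apply: noW; exists g; exists (Q i (pi g v0)) => // h hv.
  by rewrite -Qequiv ?hv// => y /(N_mono i1i); exact: i1P.
(* On the image of [f] every term of the average equals [w0], so [Q i (f w0)] is the index of [N i]
   times [w0], which is nonzero. *)
- have /asboolP/(_ 1%g)[i1 h1] := SV (f w0).
  have := h1 (maxn i0 i1) (leq_maxr _ _); rewrite repr1 /Q.
  under eq_bigr => j _.
    have := f_int (s (maxn i0 i1) j)^-1%g w0; rewrite /= => <-.
    rewrite qK repr_invKV; over.
  rewrite sumr_const card_ord => /eqP.
  rewrite -scaler_nat scaler_eq0 (negPf w0_neq0) orbF pnatr_eq0.
  have [_ _ _ sE] := sP (maxn i0 i1).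
  have [j _] := sE 1%g I.
  by rewrite eqn0Ngt (leq_ltn_trans _ (ltn_ord j)).
Qed.

End Transfer.
End RepresentationTheory.

(** * Arithmetic of p-adic fields *)

Section FractionalIdeals.
Variable k : padicField.
Implicit Types (x y : k) (n m : int).

Lemma PidealE n x : x != 0 -> (x \in Pideal k n) = (n <= pval x).
Proof. by rewrite inE => /negPf ->. Qed.

Lemma Pideal_val x : x \in Pideal k (pval x).
Proof. by rewrite inE lexx orbT. Qed.

Lemma Pideal_le m n x : m <= n -> x \in Pideal k n -> x \in Pideal k m.
Proof.
by move=> mn; rewrite !inE => /orP[->//|/(le_trans mn) ->]; rewrite orbT.
Qed.

Lemma PidealB n x y : x \in Pideal k n -> y \in Pideal k n -> x - y \in Pideal k n.
Proof. by move=> xn yn; exact/PidealD/PidealN. Qed.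

Lemma PidealBC n x y : (x - y \in Pideal k n) = (y - x \in Pideal k n).
Proof. by apply/idP/idP => /PidealN; rewrite opprB. Qed.

Lemma PidealM_le a b n x y :
  x \in Pideal k a -> y \in Pideal k b -> n <= a + b -> x * y \in Pideal k n.
Proof. by move=> xa yb nab; exact/(Pideal_le nab)/PidealM. Qed.

Lemma PidealMl n x y : x \in Pideal k 0 -> y \in Pideal k n -> x * y \in Pideal k n.
Proof. by move=> x0 yn; apply: (PidealM_le x0 yn); rewrite add0r. Qed.

Lemma PidealMr n x y : x \in Pideal k n -> y \in Pideal k 0 -> x * y \in Pideal k n.
Proof. by rewrite mulrC => xn y0; exact: PidealMl. Qed.

Lemma pvalV x : x != 0 -> pval x^-1 = - pval x.
Proof.
move=> x0; have := pvalM x0 (invr_neq0 x0); rewrite divff// pval1 => /esym/eqP.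
by rewrite addr_eq0 => /eqP ->; rewrite opprK.
Qed.

Lemma Pideal_divr n x y : x != 0 ->
  (y / x \in Pideal k n) = (y \in Pideal k (n + pval x)).
Proof.
move=> x0; apply/idP/idP => [h|h].
  by rewrite -(divfK x0 y); apply: (PidealM_le h (Pideal_val x)).
by apply: (PidealM_le h (Pideal_val _)); rewrite pvalV// addrK.
Qed.

Lemma Pideal_eq0 x : (forall n, x \in Pideal k n) -> x = 0.
Proof.
move=> h; apply/eqP; have /orP[//|] := h (pval x + 1).
by rewrite gerDl.
Qed.

Lemma pval_unit x : x \in Pideal k 0 -> x \notin Pideal k 1 -> x != 0 /\ pval x = 0.
Proof.
have [->|x0] := eqVneq x 0; first by rewrite !Pideal0.
by rewrite !PidealE// => x1 x2; split=> //; apply/eqP; lia.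
Qed.

Lemma Pideal_unit x : x != 0 -> pval x = 0 -> (x \in Pideal k 0) * (x^-1 \in Pideal k 0).
Proof. by move=> x0 vx; rewrite !PidealE ?invr_eq0// pvalV// vx. Qed.

Lemma Pideal_one_plus x n : 0 < n -> x - 1 \in Pideal k n ->
  [/\ x != 0, pval x = 0, x \in Pideal k 0 & x^-1 \in Pideal k 0].
Proof.
move=> n0 x1; have x0 : x \in Pideal k 0.
  by rewrite -(subrK 1 x) PidealD ?Pideal_one//; apply: Pideal_le x1; exact: ltW.
have [|xn0 vx] := pval_unit x0; last by split=> //; have [] := Pideal_unit xn0 vx.
apply/negP => xP; have : 1 \in Pideal k 1.
  by rewrite -[1 in X in X \in _](subKr x); apply: PidealB => //; apply: Pideal_le x1; rewrite -gtz0_ge1.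
by rewrite PidealE ?oner_neq0// pval1.
Qed.

Lemma Pideal_MunitE n x y : y != 0 -> pval y = 0 ->
  (x * y \in Pideal k n) = (x \in Pideal k n).
Proof.
by move=> y0 vy; rewrite -[y]invrK Pideal_divr ?invr_eq0// pvalV// vy oppr0 addr0.
Qed.

Lemma reduction0 : reduction (0 : k) = 0.
Proof. by apply/eqP; rewrite reduction_ker ?Pideal0. Qed.

Lemma reductionB x y : x \in Pideal k 0 -> y \in Pideal k 0 ->
  reduction (x - y) = reduction x - reduction y.
Proof.
move=> x0 y0; apply/eqP; rewrite eq_sym subr_eq -reductionD ?subrK//.
exact: PidealB.
Qed.

Lemma reduction_eq x y : x \in Pideal k 0 -> y \in Pideal k 0 ->
  (reduction x == reduction y) = (x - y \in Pideal k 1).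
Proof. by move=> x0 y0; rewrite -subr_eq0 -reductionB// reduction_ker// PidealB. Qed.

(** An arbitrary lift of a residue class, not the multiplicative section that the name suggests. *)
Definition teich (a : residue_field k) : k := s2val (cid2 (reduction_surj a)).

Lemma teich_int a : teich a \in Pideal k 0.
Proof. by rewrite /teich; case: cid2. Qed.

Lemma teichK a : reduction (teich a) = a.
Proof. by rewrite /teich; case: cid2. Qed.

Lemma teich_near x : x \in Pideal k 0 -> x - teich (reduction x) \in Pideal k 1.
Proof. by move=> x0; rewrite -reduction_eq ?teich_int// teichK. Qed.

Section Uniformizer.
Variables (w : k) (w_unif : uniformizer w).

Lemma unif_neq0 : w != 0. Proof. by have [] := w_unif. Qed.

Lemma pval_unif_exp n : pval (w ^ n) = n.
Proof.
have [w0 w1] := w_unif.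
suff h (m : nat) : pval (w ^ (m : int)) = m.
  by case: n => n //; rewrite NegzE -invr_expz pvalV ?h// expfz_neq0.
elim: m => [|m IHm]; first by rewrite expr0z pval1.
by rewrite intS expfzDr// expr1z pvalM ?expfz_neq0// w1 IHm.
Qed.

Lemma unif_exp_neq0 n : w ^ n != 0. Proof. by rewrite expfz_neq0// unif_neq0. Qed.

Lemma unif_expP n : w ^ n \in Pideal k n.
Proof. by rewrite -[X in Pideal k X](pval_unif_exp n) Pideal_val. Qed.

(** Digit expansion: [c] records the leading residue, then recursively the class of the remainder
    divided by [w]. *)
Lemma residues_finite (N : nat) : exists (T : finType) (c : k -> T),
  {in Pideal k 0 &, forall x y, c x = c y -> x - y \in Pideal k N}.
Proof.
have [w0 w1] := w_unif.
elim: N => [|N [T [c cP]]].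
  by exists unit, (fun=> tt) => x y x0 y0 _; exact: PidealB.
have h x : x \in Pideal k 0 -> (x - teich (reduction x)) / w \in Pideal k 0.
  by move=> x0; rewrite Pideal_divr// w1 add0r teich_near.
exists (residue_field k * T)%type,
  (fun x => (reduction x, c ((x - teich (reduction x)) / w))).
move=> x y x0 y0 [e]; rewrite e => /cP; rewrite -e h// e h// => /(_ isT isT).
rewrite -mulrBl Pideal_divr// w1 opprB addrA subrK; apply: Pideal_le; lia.
Qed.

End Uniformizer.
End FractionalIdeals.

(** * Square roots and square classes in odd residue characteristic *)

Section OddResidue.
Variables (k : padicField) (p : nat).
Hypotheses (pcharp : p \in [pchar (residue_field k)]) (p_odd : odd p).

Lemma reduction_nat n : reduction (n%:R : k) = n%:R /\ (n%:R : k) \in Pideal k 0.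
Proof.
elim: n => [|n [IHn n0]]; first by rewrite reduction0 Pideal0.
by rewrite !mulrS reductionD ?Pideal_one// IHn reduction1 PidealD ?Pideal_one.
Qed.

Lemma two_unit : (2 : k) != 0 /\ pval (2 : k) = 0.
Proof.
have [r2 i2] := reduction_nat 2.
apply: pval_unit => //; rewrite -reduction_ker// r2.
rewrite -(dvdn_pcharf pcharp) dvdn_prime2 ?(pcharf_prime pcharp)//.
by apply: contraTN p_odd => /eqP ->.
Qed.

Lemma Pideal_half n x : x \in Pideal k n -> x / 2 \in Pideal k n.
Proof. by have [t0 t1] := two_unit; rewrite Pideal_divr// t1 addr0. Qed.

(* Contraction: y solves (1 + y)^2 = 1 + h iff y = (h - y^2) / 2. *)
Lemma sqrt_one_plus (h : k) : h \in Pideal k 1 -> exists y, (1 + y) ^+ 2 = 1 + h.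
Proof.
move=> h1; have [two0 _] := two_unit.
pose u := fix u n := if n is n'.+1 then (h - u n' ^+ 2) / 2 else 0.
have u1 n : u n \in Pideal k 1.
  elim: n => [|n IHn] /=; first exact: Pideal0.
  by apply: Pideal_half; apply: PidealB => //; apply: (PidealM_le IHn IHn).
have uS n : u n.+1 - u n \in Pideal k n.
  elim: n => [|n IHn]; first by apply: Pideal_le (PidealB (u1 1%N) (u1 0%N)).
  have -> : u n.+2 - u n.+1 = - ((u n.+1 - u n) * (u n.+1 + u n) / 2).
    rewrite [u n.+2]/= -/(u n.+1) {2}[u n.+1]/=; field.
    exact: two0.
  apply: PidealN; apply: Pideal_half; apply: (PidealM_le IHn (PidealD (u1 _) (u1 _))).
  by lia.
have uD N i : u (N + i)%N - u N \in Pideal k N.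
  elim: i => [|i IHi]; first by rewrite addn0 subrr Pideal0.
  rewrite addnS -(subrK (u (N + i)%N) (u _.+1)) -addrA; apply: PidealD => //.
  by apply: Pideal_le (uS _); rewrite lez_nat leq_addr.
have [|y yP] := @padic_complete k u.
  move=> n; exists `|n|%N => i j Ni Nj.
  rewrite -(subrK (u `|n|%N) (u i)) -addrA; apply: (@Pideal_le _ _ `|n|%N).
    by rewrite abszE ler_norm.
  apply: PidealD; first by rewrite -(subnKC Ni).
  by rewrite PidealBC -(subnKC Nj).
have y1 : y \in Pideal k 1.
  have [N NP] := yP 1; have := PidealB (u1 N) (NP N (leqnn _)).
  by rewrite opprB addrCA subrr addr0.
exists y; apply/eqP; rewrite -subr_eq0; apply/eqP/Pideal_eq0 => n.
have [N NP] := yP n.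
have yN : y - u N \in Pideal k n by rewrite PidealBC NP.
have yN1 : y - u N.+1 \in Pideal k n by rewrite PidealBC NP.
(* The recursion gives 2 u_(N+1) = h - u_N^2, so the error is controlled by the distance from [y] to
   two consecutive iterates. *)
have -> : (1 + y) ^+ 2 - (1 + h) = 2 * (y - u N.+1) + (y - u N) * (y + u N).
  by rewrite /= -/(u N); field.
apply: PidealD; first by apply: PidealMl => //; have [] := reduction_nat 2.
apply: PidealMr => //; apply: (@Pideal_le _ _ 1) => //; exact: PidealD.
Qed.

(** If c lifts a square root of the residue of e, then e / c^2 lies in 1 + P and has a square
    root. *)
Lemma nonsquare_residue (e : k) : e \in Pideal k 0 -> e \notin Pideal k 1 ->
  ~ is_square e ->
  forall b, reduction e != b ^+ 2.
Proof.
move=> e0 e1 esq b; apply/negP => /eqP eb.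
have [en0 ve] := pval_unit e0 e1.
have c0 := teich_int b; set c := teich b in c0.
have c2 : c ^+ 2 \in Pideal k 0 by apply: PidealMl.
have ec : e - c ^+ 2 \in Pideal k 1 by rewrite -reduction_eq// reductionM// teichK eb.
have c1 : c \notin Pideal k 1.
  apply: contra e1 => c1; rewrite -(subrK (c ^+ 2) e); apply: PidealD => //.
  exact: PidealMl.
have [cn0 vc] := pval_unit c0 c1.
have [|y yP] := @sqrt_one_plus (e / c ^+ 2 - 1).
  rewrite -[X in _ - X](divff (expf_neq0 2 cn0)) -mulrBl Pideal_divr ?expf_neq0//.
  by rewrite pvalM// vc.
apply: esq; exists (c * (1 + y)); rewrite exprMn yP addrC subrK mulrC divfK//.
exact: expf_neq0.
Qed.

End OddResidue.

(** The unit group is cyclic and nonsquares are odd powers of a generator. *)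
Lemma finField_nonsquareM (F : finFieldType) (a b : F) :
  (forall c, a != c ^+ 2) -> (forall c, b != c ^+ 2) -> exists c, a * b = c ^+ 2.
Proof.
have /cyclicP[z zP] := field_unit_group_cyclic (setT_group {unit F}).
have pow (c : F) : (forall d, c != d ^+ 2) -> exists i, c = (FinRing.uval z) ^+ (2 * i).+1.
  move=> csq; have c0 : c \is a GRing.unit.
    by rewrite unitfE; have := csq 0; rewrite expr0n.
  have : FinRing.unit F c0 \in <[z]>%g by rewrite -zP inE.
  move=> /cycleP[i /(congr1 val)/= ci].
  have {}ci : c = FinRing.uval z ^+ i by rewrite ci; elim: i {ci} => //= i IHi;
    rewrite expgS exprS /= IHi.
  move: (odd_double_half i) ci; case: (odd i) => /= <- ci.
    by exists i./2; rewrite mul2n.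
  by have := csq (FinRing.uval z ^+ i./2); rewrite ci -exprM muln2 eqxx.
move=> /pow[i ->] /pow[j ->]; exists (FinRing.uval z ^+ (i + j).+1).
by rewrite -exprD -exprM; congr (_ ^+ _); lia.
Qed.

(** Residue units form at most two square classes, and [eps] represents the nontrivial one. This is
    where the two families indexed by 1 and [eps] come from. *)
Lemma unit_square_class (k : padicField) (p : nat)
    (pcharp : p \in [pchar (residue_field k)]) (p_odd : odd p)
    (eps : k) (eps_nonsq : standard_nonsquare eps) (u : k) :
  u \in Pideal k 0 -> u \notin Pideal k 1 ->
  exists a, [/\ a != 0, pval a = 0 &
    u * a ^+ 2 - 1 \in Pideal k 1 \/ u * a ^+ 2 - eps \in Pideal k 1].
Proof.
move=> u0 u1; have [e0 ve esq _] := eps_nonsq.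
have eI : eps \in Pideal k 0 by rewrite PidealE// ve.
have eN : eps \notin Pideal k 1 by rewrite PidealE// ve.
have ebar := nonsquare_residue pcharp p_odd eI eN esq.
have ru0 : reduction u != 0 by rewrite reduction_ker.
have lift (b : residue_field k) : b != 0 ->
    [/\ teich b != 0, pval (teich b) = 0 & teich b \in Pideal k 0].
  move=> b0; have [|tn0 tv] := pval_unit (teich_int b); last by rewrite teich_int.
  by rewrite -reduction_ker ?teich_int// teichK.
have [[b ub]|/forallNP usq] := EM (exists b, reduction u = b ^+ 2).
  have b0 : b^-1 != 0 by rewrite invr_eq0; apply: contraNneq ru0 => b0; rewrite ub b0 expr0n.
  have [t0 tv tI] := lift _ b0; exists (teich b^-1); split => //; left.
  have t2 : teich b^-1 ^+ 2 \in Pideal k 0 by apply: PidealMl.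
  rewrite -reduction_eq ?Pideal_one ?PidealMl// reductionM// (reductionM tI tI).
  by rewrite reduction1 teichK ub -expr2 exprVn divff// expf_neq0// -invr_eq0.
have [c cP] : exists c, reduction u * reduction eps = c ^+ 2.
  by apply: finField_nonsquareM => // c; apply/eqP.
have re0 : reduction eps != 0 by rewrite reduction_ker.
have c0 : c != 0.
  by apply: contraTneq (mulf_neq0 ru0 re0) => c0; rewrite cP c0 expr0n eqxx.
(* In the residue field u eps = c^2, hence u (eps / c)^2 = eps. *)
have d0 : reduction eps / c != 0 by rewrite mulf_neq0 ?invr_eq0.
have [t0 tv tI] := lift _ d0; exists (teich (reduction eps / c)); split => //; right.
have t2 : teich (reduction eps / c) ^+ 2 \in Pideal k 0 by apply: PidealMl.
rewrite -reduction_eq ?PidealMl// reductionM// (reductionM tI tI) teichK.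
have -> : reduction u * (reduction eps / c * (reduction eps / c)) =
  (reduction u * reduction eps) * reduction eps / c ^+ 2 by field.
by rewrite cP mulrAC divff ?mul1r// expf_neq0.
Qed.

(** * Additive characters and subgroups of K *)

Section AdditiveCharacter.
Variables (k : padicField) (C : numFieldType) (Psi : k -> C).
Hypothesis PsiP : depth_zero_character Psi.

Lemma PsiD x y : Psi (x + y) = Psi x * Psi y.
Proof. by have [h _ _] := PsiP; exact: h. Qed.

Lemma Psi_P x : x \in Pideal k 1 -> Psi x = 1.
Proof. by have [_ h _] := PsiP; exact: h. Qed.

Lemma Psi0 : Psi 0 = 1.
Proof. by rewrite Psi_P ?Pideal0. Qed.

Lemma PsiN x : Psi (- x) = (Psi x)^-1.
Proof.
have xN : Psi x * Psi (- x) = 1 by rewrite -PsiD subrr Psi0.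
by rewrite -[LHS](mulKf (_ : Psi x != 0)) ?xN ?mulr1//; apply: contra_eq_neq xN => ->;
  rewrite mul0r eq_sym oner_neq0.
Qed.

Lemma Psi_neq0 x : Psi x != 0.
Proof.
by apply/eqP => x0; have := PsiD x (- x); rewrite subrr Psi0 x0 mul0r => /eqP;
  rewrite oner_eq0.
Qed.

Lemma Psi_congr x y : x - y \in Pideal k 1 -> Psi x = Psi y.
Proof. by move=> xy; rewrite -(subrK y x) PsiD Psi_P// mul1r. Qed.

(** Otherwise c P^n contains the ring of integers, where [Psi] is nontrivial. All congruences on
    intertwining elements are extracted through this duality. *)
Lemma Psi_trivial c n :
  (forall x, x \in Pideal k n -> Psi (c * x) = 1) -> c \in Pideal k (1 - n).
Proof.
have [->|c0] := eqVneq c 0; first by rewrite Pideal0.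
move=> h; have [//|cn] := boolP (c \in Pideal k (1 - n)).
have [_ _ [y0 y0I /eqP[]]] := PsiP.
suff yc : y0 / c \in Pideal k n by rewrite -(divfK c0 y0) mulrC h.
by move: cn; rewrite Pideal_divr// (PidealE _ c0) => cn; apply: Pideal_le y0I; lia.
Qed.

(** Orthogonality: since [Psi] is trivial on P, the summand is a nontrivial additive character of
    the residue field, whatever the lifts. *)
Lemma Psi_sum x : x \in Pideal k 0 -> x \notin Pideal k 1 ->
  \sum_(a : residue_field k) Psi (teich a * x) = 0.
Proof.
move=> x0 x1; have [y yI yN] : exists2 y, y \in Pideal k 0 & Psi (y * x) != 1.
  have [_ _ [y0 y0I y01]] := PsiP; have [xn0 vx] := pval_unit x0 x1.
  by exists (y0 / x); rewrite ?divfK// Pideal_divr// vx.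
set S := \sum_a _; have : S = Psi (y * x) * S.
  rewrite {1}/S (reindex_inj (addrI (reduction y)))/= mulr_sumr.
  apply: eq_bigr => a _; rewrite -PsiD -mulrDl; apply: Psi_congr.
  rewrite -mulrBl; apply: PidealMr => //.
  by rewrite -reduction_eq ?teich_int ?PidealD ?teich_int// teichK reductionD ?teich_int// teichK.
move=> /eqP; rewrite -subr_eq0 -{1}[S]mul1r -mulrBl mulf_eq0 subr_eq0 eq_sym (negPf yN).
by move=> /eqP.
Qed.

End AdditiveCharacter.

Lemma sum_ord2 (U : nmodType) (F : 'I_2 -> U) : \sum_i F i = F 0 + F 1.
Proof.
rewrite big_ord_recl big_ord_recl big_ord0 addr0; congr (_ + F _).
exact/val_inj.
Qed.

Lemma forall_ord2 (Q : 'I_2 -> Prop) : Q 0 -> Q 1 -> forall i, Q i.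
Proof.
by move=> Q0 Q1 [[|[|//]] i2]; [move: Q0|move: Q1]; congr Q; exact/val_inj.
Qed.

Lemma det_mx22 (F : comNzRingType) (A : 'M[F]_2) :
  \det A = A 0 0 * A 1 1 - A 0 1 * A 1 0.
Proof.
have l0 : lift 0 0 = 1 :> 'I_2 by exact/val_inj.
have l1 : lift 1 0 = 0 :> 'I_2 by exact/val_inj.
rewrite (expand_det_row _ 0) sum_ord2 /cofactor !det_mx11 !mxE !l0 !l1 /=.
by rewrite expr0 expr1 mul1r mulN1r mulrN.
Qed.

Section SL2Entries.
Variable F : fieldType.
Implicit Types g h : SL2 F.

Definition mx2 (a b c d : F) : 'M[F]_2 := \matrix_(i, j)
  if i == 0 then if j == 0 then a else b else if j == 0 then c else d.

Lemma SL2_detE g :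
  \val g 0 0 * \val g 1 1 - \val g 0 1 * \val g 1 0 = 1.
Proof. by rewrite -[RHS](SL2_det g) det_mx22. Qed.

Lemma SL2_mulE g h i j :
  \val (g * h)%g i j = \val g i 0 * \val h 0 j + \val g i 1 * \val h 1 j.
Proof. by rewrite mxE sum_ord2. Qed.

Lemma SL2_eqP g h : \val g 0 0 = \val h 0 0 -> \val g 0 1 = \val h 0 1 ->
  \val g 1 0 = \val h 1 0 -> \val g 1 1 = \val h 1 1 -> g = h.
Proof.
move=> e00 e01 e10 e11; apply/val_inj/matrixP.
by apply: forall_ord2; apply: forall_ord2.
Qed.

(** The value is the identity when the determinant is not 1, so that matrices can be written down
    before the determinant is checked. *)
Definition mkSL2 (a b c d : F) : SL2 F := insubd (1%g : SL2 F) (mx2 a b c d).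

Lemma mkSL2E a b c d : a * d - b * c = 1 -> \val (mkSL2 a b c d) = mx2 a b c d.
Proof. by move=> e; rewrite insubdK// -topredE /= det_mx22 !mxE/= e. Qed.

Lemma SL2_invE g :
  \val (g^-1)%g = mx2 (\val g 1 1) (- \val g 0 1) (- \val g 1 0) (\val g 0 0).
Proof.
have e : \val g 1 1 * \val g 0 0 - - \val g 0 1 * - \val g 1 0 = 1.
  by rewrite mulrNN mulrC SL2_detE.
rewrite -(mkSL2E e); congr (\val _); apply: (mulgI g); rewrite mulgV.
have := SL2_detE g; move: (mkSL2E e) => E d.
by apply: SL2_eqP; rewrite SL2_mulE E !mxE/= ?mulr1n ?mulr0n;
  [rewrite -[LHS]d/=; ring | ring | ring | rewrite -[LHS]d/=; ring].
Qed.

End SL2Entries.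

Section Entries.
Variable k : padicField.
Implicit Types x y : SL2R k.

Definition ent x (i j : 'I_2) : k := \val (\val x) i j.

Lemma ent_int x i j : ent x i j \in Pideal k 0.
Proof. by have /integral_SL2P := valP x; exact. Qed.

Lemma ent_det x : ent x 0 0 * ent x 1 1 - ent x 0 1 * ent x 1 0 = 1.
Proof. exact: SL2_detE. Qed.

Lemma entM x y i j : ent (x * y)%g i j = ent x i 0 * ent y 0 j + ent x i 1 * ent y 1 j.
Proof. by rewrite /ent valM SL2_mulE. Qed.

Lemma ent1 i j : ent 1%g i j = (i == j)%:R.
Proof. by rewrite /ent val1 !mxE. Qed.

Lemma entV x i j :
  ent x^-1%g i j = mx2 (ent x 1 1) (- ent x 0 1) (- ent x 1 0) (ent x 0 0) i j.
Proof. by rewrite /ent gmulfV SL2_invE. Qed.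

Definition mkK (a b c d : k) : SL2R k := insubd (1%g : SL2R k) (mkSL2 a b c d).

Lemma mkKE a b c d : a * d - b * c = 1 ->
  a \in Pideal k 0 -> b \in Pideal k 0 -> c \in Pideal k 0 -> d \in Pideal k 0 ->
  forall i j, ent (mkK a b c d) i j = mx2 a b c d i j.
Proof.
move=> e aI bI cI dI i j; rewrite /ent insubdK ?mkSL2E//.
apply/integral_SL2P; rewrite mkSL2E//.
by apply: forall_ord2; apply: forall_ord2; rewrite mxE.
Qed.

Lemma SL2R_eqP x y : ent x 0 0 = ent y 0 0 -> ent x 0 1 = ent y 0 1 ->
  ent x 1 0 = ent y 1 0 -> ent x 1 1 = ent y 1 1 -> x = y.
Proof. by move=> e00 e01 e10 e11; apply/val_inj/SL2_eqP. Qed.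

End Entries.

Ltac pid := first [ done | exact: ent_int | exact: Pideal0 | exact: Pideal_one |
  lazymatch goal with
  | |- is_true (_ + _ \in _) => apply: PidealD; pid
  | |- is_true (- _ \in _) => apply: PidealN; pid
  | |- is_true (_ * _ \in _) => first [by apply: PidealMl; pid | by apply: PidealMr; pid]
  end].

Section CompactSubgroups.
Variable k : padicField.
Implicit Types x y g h : SL2R k.

(** For al = n = 1 this is the pro-p Iwahori subgroup. *)
Definition Iw (al n : int) : set (SL2R k) := [set x |
  [/\ ent x 0 0 - 1 \in Pideal k al, ent x 1 1 - 1 \in Pideal k al &
      ent x 1 0 \in Pideal k n]].

Definition Kcong (N : int) : set (SL2R k) := [set x |
  [/\ ent x 0 0 - 1 \in Pideal k N, ent x 0 1 \in Pideal k N,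
      ent x 1 0 \in Pideal k N & ent x 1 1 - 1 \in Pideal k N]].

(** In a product, upper right times lower left lands on the diagonal; [al <= n] keeps this term in
    P^al. *)
Lemma Iw_subgroup al n : al <= n -> is_subgroup (Iw al n).
Proof.
move=> aln; split; first by rewrite /Iw /= !ent1/= subrr !Pideal0.
- move=> x y [x0 x1 xc] [y0 y1 yc].
  have xc' := Pideal_le aln xc; have yc' := Pideal_le aln yc; split; rewrite !entM.
  + have -> : ent x 0 0 * ent y 0 0 + ent x 0 1 * ent y 1 0 - 1 =
      ent x 0 0 * (ent y 0 0 - 1) + (ent x 0 0 - 1) + ent x 0 1 * ent y 1 0 by ring.
    by pid.
  + have -> : ent x 1 0 * ent y 0 1 + ent x 1 1 * ent y 1 1 - 1 =
      ent x 1 1 * (ent y 1 1 - 1) + (ent x 1 1 - 1) + ent x 1 0 * ent y 0 1 by ring.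
    by pid.
  + by pid.
- by move=> x [x0 x1 xc]; split; rewrite entV mxE/=; pid.
Qed.

Lemma Kcong_subgroup N : is_subgroup (Kcong N).
Proof.
split; first by rewrite /Kcong /= !ent1/= subrr !Pideal0.
- move=> x y [x0 xb xc x1] [y0 yb yc y1]; split; rewrite !entM.
  + have -> : ent x 0 0 * ent y 0 0 + ent x 0 1 * ent y 1 0 - 1 =
      ent x 0 0 * (ent y 0 0 - 1) + (ent x 0 0 - 1) + ent x 0 1 * ent y 1 0 by ring.
    by pid.
  + by pid.
  + by pid.
  + have -> : ent x 1 0 * ent y 0 1 + ent x 1 1 * ent y 1 1 - 1 =
      ent x 1 1 * (ent y 1 1 - 1) + (ent x 1 1 - 1) + ent x 1 0 * ent y 0 1 by ring.
    by pid.
- by move=> x [x0 xb xc x1]; split; rewrite entV mxE/=; pid.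
Qed.

Lemma Kcong_normal N : normal_subset (Kcong N).
Proof.
move=> g h [h0 hb hc h1]; have := ent_det g.
set a := ent g 0 0; set b := ent g 0 1; set c := ent g 1 0; set d := ent g 1 1 => D.
split; rewrite !entM !entV !mxE/= -/a -/b -/c -/d.
- have -> : (a * ent h 0 0 + b * ent h 1 0) * d + (a * ent h 0 1 + b * ent h 1 1) * - c - 1 =
    a * d * (ent h 0 0 - 1) + b * d * ent h 1 0 - a * c * ent h 0 1
      - b * c * (ent h 1 1 - 1) by rewrite -[X in _ - X = _]D; ring.
  by rewrite /a /b /c /d; pid.
- have -> : (a * ent h 0 0 + b * ent h 1 0) * - b + (a * ent h 0 1 + b * ent h 1 1) * a =
    - (a * b * (ent h 0 0 - 1)) - b * b * ent h 1 0 + a * a * ent h 0 1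
      + a * b * (ent h 1 1 - 1) by ring.
  by rewrite /a /b /c /d; pid.
- have -> : (c * ent h 0 0 + d * ent h 1 0) * d + (c * ent h 0 1 + d * ent h 1 1) * - c =
    c * d * (ent h 0 0 - 1) + d * d * ent h 1 0 - c * c * ent h 0 1
      - c * d * (ent h 1 1 - 1) by ring.
  by rewrite /a /b /c /d; pid.
- have -> : (c * ent h 0 0 + d * ent h 1 0) * - b + (c * ent h 0 1 + d * ent h 1 1) * a - 1 =
    - (b * c * (ent h 0 0 - 1)) - b * d * ent h 1 0 + a * c * ent h 0 1
      + a * d * (ent h 1 1 - 1) by rewrite -[X in _ - X = _]D; ring.
  by rewrite /a /b /c /d; pid.
Qed.

Lemma Kcong_mono m n : m <= n -> Kcong n `<=` Kcong m.
Proof. by move=> mn x [x0 x1 x2 x3]; split; apply: (Pideal_le mn). Qed.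

Lemma Kcong_Iw al n N : al <= N -> n <= N -> Kcong N `<=` Iw al n.
Proof.
move=> aN nN x [x0 x1 x2 x3].
by split; [apply: (Pideal_le aN)|apply: (Pideal_le aN)|apply: (Pideal_le nN)].
Qed.

Lemma Iw_mono al be m n : al <= be -> m <= n -> Iw be n `<=` Iw al m.
Proof.
move=> ab mn x [x0 x1 x2].
by split; [apply: (Pideal_le ab)|apply: (Pideal_le ab)|apply: (Pideal_le mn)].
Qed.

Lemma Kcong_finite_index (w : k) (w_unif : uniformizer w) (H : set (SL2R k)) (N : nat) :
  exists n (s : 'I_n -> SL2R k), coset_reps H (Kcong N) s.
Proof.
have [T [c cP]] := residues_finite w_unif N.
apply: (@coset_reps_exist _ _ _ (T * T * (T * T))%type
  (fun x => (c (ent x 0 0), c (ent x 0 1), (c (ent x 1 0), c (ent x 1 1))))).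
  exact: Kcong_subgroup.
move=> g h _ _ [] /cP h00 /cP h01 /cP h10 /cP h11.
move: h00 h01 h10 h11 => /(_ (ent_int _ _ _) (ent_int _ _ _)) h00
  /(_ (ent_int _ _ _) (ent_int _ _ _)) h01 /(_ (ent_int _ _ _) (ent_int _ _ _)) h10
  /(_ (ent_int _ _ _) (ent_int _ _ _)) h11.
have D := ent_det g.
split; rewrite !entM !entV !mxE/=.
- have -> : ent g 1 1 * ent h 0 0 + - ent g 0 1 * ent h 1 0 - 1 =
    - (ent g 1 1 * (ent g 0 0 - ent h 0 0)) + ent g 0 1 * (ent g 1 0 - ent h 1 0).
    by rewrite -[X in _ - X = _]D; ring.
  by pid.
- have -> : ent g 1 1 * ent h 0 1 + - ent g 0 1 * ent h 1 1 =
    - (ent g 1 1 * (ent g 0 1 - ent h 0 1)) + ent g 0 1 * (ent g 1 1 - ent h 1 1) by ring.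
  by pid.
- have -> : - ent g 1 0 * ent h 0 0 + ent g 0 0 * ent h 1 0 =
    ent g 1 0 * (ent g 0 0 - ent h 0 0) - ent g 0 0 * (ent g 1 0 - ent h 1 0) by ring.
  by pid.
- have -> : - ent g 1 0 * ent h 0 1 + ent g 0 0 * ent h 1 1 - 1 =
    ent g 1 0 * (ent g 0 1 - ent h 0 1) - ent g 0 0 * (ent g 1 1 - ent h 1 1).
    by rewrite -[X in _ - X = _]D; ring.
  by pid.
Qed.

End CompactSubgroups.

(** * Intertwining *)

Ltac ilia :=
  repeat match goal with
  | H : ?Q |- _ => lazymatch type of Q with Prop => lazymatch Q with
      | is_true (@Order.le _ _ _ _) => fail
      | is_true (@Order.lt _ _ _ _) => fail
      | @eq _ (_ + _) (_ + _) => fail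
      | _ => clear H end end
  end; lia.

Section IwahoriCharacter.
Variables (k : padicField) (p : nat).
Hypotheses (pcharp : p \in [pchar (residue_field k)]) (p_odd : odd p).
Variables (w : k) (w_unif : uniformizer w).
Variables (C : numFieldType) (Psi : k -> C) (PsiP : depth_zero_character Psi).
Implicit Types x y g h : SL2R k.

(** This is [PsiX] for X = [antidiag u 0]: the trace of X (x - 1) is u times the lower left entry of
    x. *)
Definition psi (t : int) (u : k) x := Psi (w ^ (- t) * u * ent x 1 0).

Lemma scaled_Pideal t u n c : u \in Pideal k 0 -> c \in Pideal k n ->
  w ^ (- t) * u * c \in Pideal k (n - t).
Proof.
move=> uI cn; apply: (PidealM_le (PidealM_le (unif_expP w_unif (- t)) uI (lexx _)) cn).
by ilia.
Qed.

Lemma scaled_Pideal_inv t u n c : u != 0 -> pval u = 0 ->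
  w ^ (- t) * u * c \in Pideal k n -> c \in Pideal k (n + t).
Proof.
move=> u0 vu; have w0 := unif_exp_neq0 w_unif (- t).
rewrite -mulrA mulrC -[w ^ (- t)]invrK Pideal_divr ?invr_eq0// pvalV//.
by rewrite pval_unif_exp// opprK mulrC Pideal_MunitE.
Qed.

Lemma psi_neq0 t u x : psi t u x != 0.
Proof. exact: Psi_neq0. Qed.

Lemma psi_small t u x : u \in Pideal k 0 -> ent x 1 0 \in Pideal k (t + 1) -> psi t u x = 1.
Proof.
move=> uI xc; apply: (Psi_P PsiP); apply: Pideal_le (scaled_Pideal t uI xc).
by ilia.
Qed.

(** Here and in the next two lemmas the upper right entry is omitted, since [Iw] does not constrain
    it. *)
Lemma conj_upper_ent g (x : k) : x \in Pideal k 0 -> let y := (g * mkK 1 x 0 1 * g^-1)%g in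
  [/\ ent y 0 0 = 1 - ent g 0 0 * ent g 1 0 * x,
      ent y 1 1 = 1 + ent g 0 0 * ent g 1 0 * x &
      ent y 1 0 = - (ent g 1 0 ^+ 2) * x].
Proof.
move=> xI; have e : 1 * 1 - x * 0 = 1 :> k by ring.
have E := mkKE e (Pideal_one k) xI (Pideal0 k 0) (Pideal_one k).
have D := ent_det g.
by split; rewrite !entM !entV !E !mxE/=; rewrite -?[X in _ = X - _]D -?[X in _ = X + _]D; ring.
Qed.

Lemma conj_lower_ent g (y : k) : y \in Pideal k 0 -> let z := (g * mkK 1 0 y 1 * g^-1)%g in
  [/\ ent z 0 0 = 1 + ent g 0 1 * ent g 1 1 * y,
      ent z 1 1 = 1 - ent g 0 1 * ent g 1 1 * y &
      ent z 1 0 = ent g 1 1 ^+ 2 * y].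
Proof.
move=> yI; have e : 1 * 1 - 0 * y = 1 :> k by ring.
have E := mkKE e (Pideal_one k) (Pideal0 k 0) yI (Pideal_one k).
have D := ent_det g.
by split; rewrite !entM !entV !E !mxE/=; rewrite -?[X in _ = X - _]D -?[X in _ = X + _]D; ring.
Qed.

Lemma conj_diag_ent g (a : k) : a != 0 -> a \in Pideal k 0 -> a^-1 \in Pideal k 0 ->
  let z := (g * mkK a 0 0 a^-1 * g^-1)%g in
  [/\ ent z 0 0 = a + ent g 0 1 * ent g 1 0 * (a - a^-1),
      ent z 1 1 = a^-1 - ent g 0 1 * ent g 1 0 * (a - a^-1) &
      ent z 1 0 = ent g 1 0 * ent g 1 1 * (a - a^-1)].
Proof.
move=> a0 aI aVI; have e : a * a^-1 - 0 * 0 = 1 :> k by rewrite divff// mul0r subr0.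
have E := mkKE e aI (Pideal0 k 0) (Pideal0 k 0) aVI.
have D := ent_det g.
split; rewrite !entM !entV !E !mxE/=; last by ring.
- by rewrite -[X in _ = X + _]mulr1 -D; ring.
- by rewrite -[X in _ = X - _]mulr1 -D; ring.
Qed.

Section Level.
Variables (al n t : int).
Hypotheses (al_gt0 : 1 <= al) (al_n : al <= n) (al_n_t : al + n = t + 1).

(** The cross terms of the lower left entry lie in P^(al + n) = P^(t + 1), and scaling by w^-t
    brings them into the kernel P of [Psi]. *)
Lemma psiM u x y : u \in Pideal k 0 -> Iw al n x -> Iw al n y ->
  psi t u (x * y)%g = psi t u x * psi t u y.
Proof.
move=> uI [x0 x1 xc] [y0 y1 yc]; rewrite /psi -PsiD//; apply: (Psi_congr PsiP).
rewrite -mulrDr -mulrBr entM.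
have -> : ent x 1 0 * ent y 0 0 + ent x 1 1 * ent y 1 0 - (ent x 1 0 + ent y 1 0) =
  ent x 1 0 * (ent y 0 0 - 1) + (ent x 1 1 - 1) * ent y 1 0 by ring.
apply: (Pideal_le _ (scaled_Pideal t uI _)) => [|]; last first.
  apply: PidealD; last exact: PidealM x1 yc.
  by rewrite [al + n]addrC; exact: PidealM.
by ilia.
Qed.

(* Upper unipotents of level t force [g 1 0] into P, then the torus elements 1 + x/2
   force it into P^n, and lower unipotents of level n give [g 1 1 ^+ 2 = 1] mod P^al. *)
Lemma psi_intertwiner u g : u != 0 -> pval u = 0 ->
  (forall x, Iw al n x -> Iw al n (g * x * g^-1)%g ->
     psi t u (g * x * g^-1)%g = psi t u x) ->
  exists s : k, [/\ s = 1 \/ s = -1, s * ent g 0 0 - 1 \in Pideal k al,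
    s * ent g 1 1 - 1 \in Pideal k al & ent g 1 0 \in Pideal k n].
Proof.
move=> u0 vu gint; have D := ent_det g.
have [uI _] := Pideal_unit u0 vu.
set a := ent g 0 0 in D *; set b := ent g 0 1 in D *.
set c := ent g 1 0 in D *; set d := ent g 1 1 in D *.
have aI : a \in Pideal k 0 by exact: ent_int.
have bI : b \in Pideal k 0 by exact: ent_int.
have cI : c \in Pideal k 0 by exact: ent_int.
have dI : d \in Pideal k 0 by exact: ent_int.
have c1 : c \in Pideal k 1.
  have c2 : c ^+ 2 \in Pideal k 1.
    suff : w ^ (- t) * u * - (c ^+ 2) \in Pideal k (1 - t).
      by move=> /(scaled_Pideal_inv u0 vu) /PidealN; rewrite opprK subrK.
    apply: (Psi_trivial PsiP) => x xt.
    have xal : x \in Pideal k al by apply: Pideal_le xt; ilia.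
    have xn : x \in Pideal k n by apply: Pideal_le xt; ilia.
    have xI : x \in Pideal k 0 by apply: Pideal_le xal; ilia.
    have e : 1 * 1 - x * 0 = 1 :> k by ring.
    have E := mkKE e (Pideal_one k) xI (Pideal0 k 0) (Pideal_one k).
    have [e0 e1 e10] := conj_upper_ent g xI.
    have := gint (mkK 1 x 0 1); rewrite /psi e10 !E !mxE/= mulr0 (Psi0 PsiP) mulrA; apply.
    - by split; rewrite E mxE/= ?subrr ?Pideal0.
    - split; rewrite ?e0 ?e1 ?e10.
      + by rewrite addrAC subrr sub0r; pid.
      + by rewrite addrAC subrr add0r; pid.
      + by rewrite exprS expr1; pid.
  apply: contraT => cN1; have [c0 vc] := pval_unit cI cN1.
  by move: c2; rewrite expr2 Pideal_MunitE// (negPf cN1).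
have ad1 : a * d - 1 \in Pideal k 1.
  by rewrite -[X in _ - X]D opprB addrCA subrr addr0; exact: PidealMl.
have [d0 vd] : d != 0 /\ pval d = 0.
  apply: pval_unit => //; apply/negP => d1.
  have : a * d - (a * d - 1) \in Pideal k 1 by apply: PidealB => //; exact: PidealMl.
  by rewrite subKr PidealE ?oner_neq0// pval1.
have cn : c \in Pideal k n.
  apply: contraT => cN.
  have c0 : c != 0 by apply: contraNneq cN => ->; exact: Pideal0.
  have vc1 : 1 <= pval c by rewrite -PidealE.
  have vcn : pval c < n by rewrite ltNge -PidealE.
  suff : w ^ (- t) * u * (c * d) \in Pideal k (1 - (t - pval c)).
    move=> /(scaled_Pideal_inv u0 vu); rewrite Pideal_MunitE// PidealE// opprB addrA subrK.
    by rewrite gerDr.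
  apply: (Psi_trivial PsiP) => x xt.
  have [two0 vtwo] := two_unit pcharp p_odd.
  have xal : x \in Pideal k al by apply: Pideal_le xt; ilia.
  have x1 : x \in Pideal k 1 by apply: Pideal_le xal; ilia.
  have hx := Pideal_half pcharp p_odd xal; have hx1 := Pideal_half pcharp p_odd x1.
  (* Since [x] is in P^(t - val c) and val c < n, the conjugate stays in [Iw al n]. As r - 1/r
     agrees with x up to P^(1 + t - val c), testing against all such x puts c in P^(1 + val c), a
     contradiction. *)
  pose r := 1 + x / 2.
  have [||r0 vr rI rVI] := @Pideal_one_plus k r 1 => //.
    by rewrite /r addrAC subrr add0r.
  have rE : r - r^-1 = x * ((1 + x / 2 / 2) / r).
    by move: r0; rewrite /r => r0; field; rewrite two0/=; move: r0; apply: contra_neq => h;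
      rewrite -[LHS](mulKf two0) -(mulr0 (2^-1)) -h; field.
  have qI : (1 + x / 2 / 2) / r - 1 \in Pideal k 1.
    have -> : (1 + x / 2 / 2) / r - 1 = - (x / 2 / 2) / r.
      by rewrite -[X in _ - X](divff r0) -mulrBl; congr (_ / _); rewrite /r; field.
    by rewrite mulrC; apply: PidealMl => //; apply: PidealN; do 2!apply: (Pideal_half pcharp p_odd).
  have rrI : r - r^-1 - x \in Pideal k (1 + (t - pval c)).
    by rewrite rE -[X in _ - X]mulr1 -mulrBr [1 + (t - _)]addrC; apply: PidealM.
  have rr : r - r^-1 \in Pideal k (t - pval c).
    by rewrite -(subrK x (r - r^-1)); apply: PidealD => //; apply: Pideal_le rrI; ilia.
  have rral : r - r^-1 \in Pideal k al by apply: Pideal_le rr; ilia.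
  have [e0 e1 e10] := conj_diag_ent g r0 rI rVI.
  have e : r * r^-1 - 0 * 0 = 1 :> k by rewrite divff// mul0r subr0.
  have E := mkKE e rI (Pideal0 k 0) (Pideal0 k 0) rVI.
  have r1 : r - 1 \in Pideal k al by rewrite /r addrAC subrr add0r.
  have rV1 : r^-1 - 1 \in Pideal k al.
    by rewrite (_ : _ - 1 = r - 1 - (r - r^-1)); [exact: PidealB|ring].
  have ct : c * (r - r^-1) \in Pideal k t.
    by apply: (PidealM_le (Pideal_val c) rr); rewrite addrC subrK.
  transitivity (psi t u (g * mkK r 0 0 r^-1 * g^-1)%g).
    apply: (Psi_congr PsiP); rewrite e10 -/c -/d.
    have -> : w ^ (- t) * u * (c * d) * x - w ^ (- t) * u * (c * d * (r - r^-1)) =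
      w ^ (- t) * u * (c * (d * (x - (r - r^-1)))) by ring.
    apply: (Pideal_le _ (@scaled_Pideal t u (t + 1) _ uI _)); first by ilia.
    apply: (PidealM_le (Pideal_val c) (_ : _ \in Pideal k (1 + (t - pval c)))).
      by apply: PidealMl => //; rewrite PidealBC.
    by ilia.
  rewrite gint; first by rewrite /psi E mxE/= mulr0 Psi0.
  - by split; rewrite E mxE/= ?Pideal0.
  - split; rewrite ?e0 ?e1 ?e10 -/b -/c -/d.
    + by rewrite addrAC; pid.
    + by rewrite addrAC; pid.
    + by rewrite mulrAC; apply: PidealMr => //; apply: Pideal_le ct; ilia.
have d2 : d ^+ 2 - 1 \in Pideal k al.
  suff : w ^ (- t) * u * (d ^+ 2 - 1) \in Pideal k (1 - n).
    by move=> /(scaled_Pideal_inv u0 vu); apply: Pideal_le; ilia.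
  apply: (Psi_trivial PsiP) => y yn.
  have yal : y \in Pideal k al by apply: Pideal_le yn.
  have yI : y \in Pideal k 0 by apply: Pideal_le yal; ilia.
  have e : 1 * 1 - 0 * y = 1 :> k by ring.
  have E := mkKE e (Pideal_one k) (Pideal0 k 0) yI (Pideal_one k).
  have [e0 e1 e10] := conj_lower_ent g yI.
  have /eqP : psi t u (g * mkK 1 0 y 1 * g^-1)%g = psi t u (mkK 1 0 y 1).
    apply: gint; first by split; rewrite E mxE/= ?subrr ?Pideal0.
    split; rewrite ?e0 ?e1 ?e10.
    + by rewrite addrAC subrr add0r; pid.
    + by rewrite addrAC subrr sub0r; pid.
    + by rewrite exprS expr1; pid.
  rewrite -(inj_eq (mulIf (psi_neq0 t u (mkK 1 0 y 1)^-1%g))) /psi -!PsiD// e10.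
  rewrite entV E !mxE/= !E !mxE/= => /eqP.
  rewrite mulrN subrr (Psi0 PsiP) -/d => <-; congr (Psi _); ring.
(* As 2 is a unit, d - 1 and d + 1 are not both in P, so one of them is a unit and the other is in
   P^al. *)
have [s [sE sd]] : exists s : k, (s = 1 \/ s = -1) /\ s * d - 1 \in Pideal k al.
  have [two0 vtwo] := two_unit pcharp p_odd.
  have [twoI _] := Pideal_unit two0 vtwo.
  have dd : (d - 1) * (d + 1) \in Pideal k al.
    by rewrite (_ : _ * _ = d ^+ 2 - 1) //; ring.
  have [dm|dm] := boolP (d - 1 \in Pideal k 1).
    exists 1; split; first by left.
    have [||dp0 vdp] := @pval_unit k (d + 1).
    - by pid.
    - apply/negP => dp; have : d + 1 - (d - 1) \in Pideal k 1 by exact: PidealB.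
      by rewrite (_ : _ - _ = 2); [rewrite PidealE// vtwo|ring].
    by rewrite mul1r; move: dd; rewrite Pideal_MunitE.
  exists (-1); split; first by right.
  have [dm0 vdm] := pval_unit (PidealB dI (Pideal_one k)) dm.
  move: dd; rewrite mulrC Pideal_MunitE// => /PidealN; rewrite opprD mulN1r.
  by [].
exists s; split => //.
have ss : s * s = 1 by case: sE => ->; ring.
have sI : s \in Pideal k 0 by case: sE => ->; pid.
have -> : s * a - 1 = - (s * a * (s * d - 1)) + (s * s * (a * d) - 1) by ring.
have -> : s * s * (a * d) - 1 = b * c by rewrite ss -[X in _ - X = _]D; ring.
apply: PidealD; first by pid.
by apply: PidealMl => //; exact: Pideal_le cn.
Qed.

End Level.
End IwahoriCharacter.

(** * Eigenvectors and induced representations *)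

Section Averaging.
Variables (C : numFieldType) (gT : groupType) (H N : set gT) (chi : gT -> C).
Variables (n : nat) (s : 'I_n -> gT).
Hypotheses (H_subgroup : is_subgroup H) (N_subgroup : is_subgroup N)
  (NH : N `<=` H) (sP : coset_reps H N s).
Hypotheses (chiM : {in H &, {morph chi : x y / (x * y)%g >-> x * y}})
  (chi_neq0 : forall x, chi x != 0) (chiN : forall x, N x -> chi x = 1).
Variables (W : lmodType C) (sigma : representation gT W).

Let chiM' x y : H x -> H y -> chi (x * y)%g = chi x * chi y.
Proof. by move=> Hx Hy; apply: chiM; rewrite inE. Qed.

Let chiV x : H x -> chi x^-1%g = (chi x)^-1.
Proof.
move=> Hx; have [H1 _ HV] := H_subgroup; apply: (mulfI (chi_neq0 x)).
rewrite -chiM' ?mulgV ?divff ?chi_neq0//; last exact: HV.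
by apply: chiN; have [] := N_subgroup.
Qed.

(** On vectors fixed by [N], the index times the projector onto the [chi]-eigenspace of [H]. *)
Definition average (v : W) : W := \sum_i (chi (s i))^-1 *: sigma (s i) v.

Lemma average_equivariant v : fixed_vector sigma N v ->
  forall h, H h -> sigma h (average v) = chi h *: average v.
Proof.
move=> vN h Hh; have [H1 HM HV] := H_subgroup; have [sH _ _ _] := sP.
pose F x := (chi x)^-1 *: sigma x v.
rewrite /average linear_sum/= -(sum_coset_reps (F := F) _ _ sP _ Hh)//.
  rewrite scaler_sumr; apply: eq_bigr => i _.
  by rewrite /F chiM'// invfM reprM linearZ/= !scalerA mulrA divff// mul1r.
move=> x y Hx Ny; have Hy := NH Ny.
by rewrite /F chiM'// reprM vN// (chiN Ny) mulr1.
Qed.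

(** The transpose of [average], turning any functional into a [chi]-equivariant one when [N] acts
    trivially. *)
Definition average_functional (l : {linear W -> C^o}) (v : W) : C^o :=
  \sum_i chi (s i) * l (sigma (s i)^-1%g v).

Lemma average_functional_linear l : linear (average_functional l).
Proof.
move=> a x y; rewrite /average_functional scaler_sumr -big_split/=.
apply: eq_bigr => i _; rewrite !linearP /GRing.scale/= mulrDr; congr (_ + _).
by rewrite mulrCA.
Qed.

Lemma average_functional_equivariant l : (forall v, fixed_vector sigma N v) ->
  forall h v, H h -> average_functional l (sigma h v) = chi h * average_functional l v.
Proof.
move=> vN h v Hh; have [H1 HM HV] := H_subgroup; have [sH _ _ _] := sP.
have [_ _ NV] := N_subgroup.
pose F x := chi x * l (sigma x^-1%g v).
rewrite /average_functional -(sum_coset_reps (F := F) _ _ sP _ (HV _ Hh))//.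
  rewrite mulr_sumr; apply: eq_bigr => i _.
  rewrite /F chiM' ?chiV//; last exact: HV.
  by rewrite mulrA mulVKf// invgM invgK reprM.
move=> x y Hx Ny; have Hy := NH Ny; have NVy := NV _ Ny.
by rewrite /F chiM'// (chiN Ny) mulr1 invgM reprM vN.
Qed.

Lemma average_functional_eigen l v : (forall h, H h -> sigma h v = chi h *: v) ->
  average_functional l v = n%:R * l v.
Proof.
move=> vH; have [H1 HM HV] := H_subgroup; have [sH _ _ _] := sP.
rewrite /average_functional (eq_bigr (fun=> l v)).
  by rewrite sumr_const card_ord mulr_natl.
move=> i _; rewrite vH; last exact/HV/sH.
by rewrite linearZ chiV// /GRing.scale/= mulrA divff// mul1r.
Qed.

End Averaging.

(* [w] generates [sigma] and [x |-> L (sigma x w)] is supported on [H], so the matrix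
   coefficient map with respect to [L] identifies [sigma] with the induced representation. *)
Lemma irreducible_isomorphic_induced (C : numFieldType) (gT : groupType) (H N : set gT)
    (chi : gT -> C) (n : nat) (s : 'I_n -> gT) (W : lmodType C)
    (sigma : representation gT W) (L : {linear W -> C^o}) (w : W) :
  is_subgroup N -> coset_reps setT N s -> is_subgroup H -> N `<=` H ->
  (forall v, fixed_vector sigma N v) ->
  irreducible sigma ->
  (forall h v, H h -> L (sigma h v) = chi h * L v) ->
  L w != 0 -> (forall g, ~ H g -> L (sigma g w) = 0) ->
  isomorphic sigma (induced H chi).
Proof.
move=> N_subgroup sP H_subgroup NH Nfix [_ irr] LH Lw0 Lsupp.
have [H1 HM HV] := H_subgroup; have [N1 NM NV] := N_subgroup.
have subT : is_subgroup [set: gT] by [].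
(* Equivariance of [L] together with [L w != 0] forces [chi] to be multiplicative on [H]. *)
have chiM x y : H x -> H y -> chi (x * y)%g = chi x * chi y.
  move=> Hx Hy; apply: (mulIf Lw0); rewrite -LH; last exact: HM.
  by rewrite reprM LH// LH// mulrA.
have chiN x : N x -> chi x = 1.
  by move=> Nx; apply: (mulIf Lw0); rewrite -LH ?Nfix ?mul1r//; exact: NH.
have Phi_ind v : (fun g => L (sigma g v)) \in ind_pred H chi.
  by apply/asboolP => h g Hh; rewrite reprM LH.
pose Phi v : ind_space H chi := Sub (fun g => L (sigma g v)) (Phi_ind v).
have Phi_lin : linear Phi.
  move=> a x y; apply/val_inj/funext => g /=.
  by rewrite !linearP.
pose F : {linear W -> ind_space H chi} :=
  HB.pack Phi (GRing.isLinear.Build C W (ind_space H chi) _ Phi Phi_lin).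
have FE v g : \val (F v) g = L (sigma g v) by [].
have Fint : intertwines sigma (induced H chi) F.
  by move=> g v; apply/val_inj/funext => x /=; rewrite reprM.
have F_inj : injective F.
  move=> x y xy; apply/eqP; rewrite -subr_eq0; apply/eqP.
  pose S : {pred W} := [pred v | `[< F v = 0 >]].
  have [||S0|SW] := irr S.
  - split; first by apply/asboolP; rewrite linear0.
    move=> a u v /asboolP u0 /asboolP v0; apply/asboolP.
    by rewrite linearP u0 v0 scaler0 addr0.
  - move=> g v /asboolP v0; apply/asboolP.
    by rewrite Fint v0 linear0.
  - by apply: S0; apply/asboolP; rewrite linearB xy subrr.
  - have /asboolP/(congr1 (fun f : ind_space H chi => \val f 1%g)) := SW w.
    by rewrite FE repr1 => /eqP; rewrite (negPf Lw0).
have F_surj f : exists v, F v = f.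
  have fP h g : H h -> \val f (h * g)%g = chi h * \val f g.
    by move=> Hh; have /asboolP := valP f; exact.
  set c : C := #|[pred i | `[< H (s i) >]]|%:R * L w.
  have c0 : c != 0.
    by rewrite mulf_neq0// pnatr_eq0 -lt0n; apply: (count_coset_reps_gt0 _ _ sP).
  (* After translating the sum by g^-1, the term at x is f(x^-1 g) L(sigma x w). It vanishes off [H]
     and equals f(g) L(w) on [H], whence the constant [c]. *)
  exists (c^-1 *: \sum_i \val f (s i)^-1%g *: sigma (s i) w).
  apply/val_inj/funext => g; rewrite FE.
  rewrite 2!linearZ/= 2!linear_sum/=.
  pose G x := \val f x^-1%g * L (sigma (g * x)%g w).
  rewrite (eq_bigr (fun i => G (s i))); last first.
    by move=> i _; rewrite 2!linearZ/= /G reprM.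
  have -> : \sum_i G (s i) = c * \val f g.
    rewrite -(sum_coset_reps (h := g^-1%g) subT N_subgroup sP)//; last first.
      move=> x y _ Ny; rewrite /G invgM fP; last exact/NH/NV.
      by rewrite (chiN _ (NV _ Ny)) mul1r mulgA [sigma (_ * y)%g w]reprM (Nfix w y Ny).
    rewrite (bigID (fun i => `[< H (s i) >]))/= [X in _ + X]big1 ?addr0; last first.
      by move=> i /asboolPn nH; rewrite /G mulgA mulgV mul1g Lsupp// mulr0.
    rewrite (eq_bigr (fun=> L w * \val f g)).
      by rewrite sumr_const -[LHS]mulr_natl; exact: mulrA.
    move=> i /asboolP Hi; rewrite /G mulgA mulgV mul1g invgM invgK fP; last exact: HV.
    rewrite LH// mulrACA -chiM//; last exact: HV.
    by rewrite mulVg chiN// mul1r mulrC.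
  exact: mulKf.
exists F => //; pose G f := sval (cid (F_surj f)).
have GP f : F (G f) = f by rewrite /G; case: cid.
by exists G => // v; apply: F_inj; rewrite GP.
Qed.

Section EigenvectorExistence.
Variable k : padicField.
Variables (w : k) (w_unif : uniformizer w).
Variables (C : numFieldType) (Psi : k -> C) (PsiP : depth_zero_character Psi).
Variables (W : lmodType C) (sigma : representation (SL2R k) W).
Implicit Types x y g h : SL2R k.

Notation psi := (psi w Psi).

Definition eigenvector (H : set (SL2R k)) (chi : SL2R k -> C) (v : W) :=
  forall h, H h -> sigma h v = chi h *: v.

(** Fourier inversion on [Iw 1 t] / [Iw 1 (t + 1)]: the projections of [v0] to all characters
    [psi t b] add up to a nonzero multiple of [v0], so one of them is nonzero. *)
Lemma exists_psi_eigenvector (t : int) (v0 : W) :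
  1 <= t -> v0 != 0 -> fixed_vector sigma (Iw 1 (t + 1)) v0 ->
  exists b v, [/\ b \in Pideal k 0, v != 0 & eigenvector (Iw 1 t) (psi t b) v].
Proof.
move=> t1 v00 v0fix.
have subH : is_subgroup (@Iw k 1 t) by exact: Iw_subgroup.
have subN : is_subgroup (@Iw k 1 (t + 1)) by apply: Iw_subgroup; lia.
have NH : @Iw k 1 (t + 1) `<=` Iw 1 t by apply: Iw_mono => //; lia.
have [n [s sP]] : exists n (s : 'I_n -> SL2R k), coset_reps (Iw 1 t) (Iw 1 (t + 1)) s.
  (* Finiteness is inherited from K / [Kcong (t + 1)], because [Kcong (t + 1)] lies in
     [Iw 1 (t + 1)]. *)
  have [n [s [_ _ sN sE]]] := Kcong_finite_index w_unif setT (absz (t + 1)).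
  pose r x := sval (cid (sE x I)).
  have rP x : Kcong (absz (t + 1)) ((s (r x))^-1 * x)%g by rewrite /r; case: cid.
  apply: (@coset_reps_exist _ _ _ _ r subN) => g h _ _ gh.
  apply: (@Kcong_Iw _ _ _ (absz (t + 1))); [by ilia|by ilia|].
  have [_ KM KV] := Kcong_subgroup k (absz (t + 1)).
  have := KM _ _ (KV _ (rP g)) (rP h).
  by rewrite gh invgM invgK !mulgA mulgK.
have psiN u x : u \in Pideal k 0 -> Iw 1 (t + 1) x -> psi t u x = 1.
  by move=> uI [_ _ xc]; exact: psi_small.
have psiM u : u \in Pideal k 0 ->
    {in Iw 1 t &, {morph psi t u : x y / (x * y)%g >-> x * y}}.
  by move=> uI x y /set_mem xI /set_mem yI; apply: (@psiM _ _ w_unif _ _ PsiP 1 t) => //; lia.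
pose e b := average (psi t b) s sigma v0.
have eP b : b \in Pideal k 0 -> eigenvector (Iw 1 t) (psi t b) (e b).
  move=> bI h Hh; apply: (average_equivariant subH subN NH sP) => //.
  - exact: psiM.
  - by move=> x; exact: psi_neq0.
  - by move=> x; exact: psiN.
have [[a ea]|/forallNP e0] := EM (exists a, e (teich a) != 0).
  by exists (teich a), (e (teich a)); split=> //; [exact: teich_int|exact/eP/teich_int].
exfalso; have : \sum_a e (teich a) = 0.
  by apply: big1 => a _; apply/eqP; have /negP := e0 a; rewrite negbK.
rewrite /e /average exchange_big/=.
have sum0 i : ~ Iw 1 (t + 1) (s i) ->
    \sum_a (psi t (teich a) (s i))^-1 *: sigma (s i) v0 = 0.
  move=> si; rewrite -scaler_suml; apply/eqP; rewrite scaler_eq0; apply/orP; left.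
  have [sH _ _ _] := sP; have [h0 h1 hc] := sH i.
  rewrite (eq_bigr (fun a => Psi (teich a * - (w ^ (- t) * ent (s i) 1 0)))).
    apply/eqP; apply: (Psi_sum PsiP).
      by apply: PidealN; apply: (PidealM_le (unif_expP w_unif (- t)) hc); rewrite addNr.
    apply/negP => /PidealN; rewrite opprK => h; apply: si; split => //.
    have := PidealM (unif_expP w_unif t) h.
    by rewrite mulrA -expfzDr ?unif_neq0// subrr expr0z mul1r.
  by move=> a _; rewrite /psi -PsiN//; congr Psi; ring.
rewrite (bigID (fun i => `[< Iw 1 (t + 1) (s i) >]))/= [X in _ + X]big1 ?addr0; last first.
  by move=> i /asboolPn; exact: sum0.
rewrite (eq_bigr (fun=> #|residue_field k|%:R *: v0)).
  rewrite sumr_const -scaler_nat scalerA => /eqP.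
  rewrite scaler_eq0 (negPf v00) orbF -natrM pnatr_eq0 muln_eq0.
  rewrite !eqn0Ngt => /orP[/negP[]|/negP[]].
    apply: (count_coset_reps_gt0 _ subN sP) => //.
    by have [] := subH.
  by apply/card_gt0P; exists 0.
move=> i /asboolP si; rewrite (eq_bigr (fun=> v0)) ?sumr_const ?scaler_nat//.
by move=> a _; rewrite psiN ?teich_int// invr1 scale1r v0fix.
Qed.

Variables (p : nat) (pcharp : p \in [pchar (residue_field k)]) (p_odd : odd p).

(** For x and g x g^-1 both in [Iw al n], evaluating F(g x) from the left and from the right shows
    that [g] intertwines [psi t u] as soon as F(g) is nonzero. *)
Lemma psi_support (al n t : int) (u : k) (F : SL2R k -> C) g :
  1 <= al -> al <= n -> al + n = t + 1 -> u != 0 -> pval u = 0 ->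
  (forall h x, Iw al n h -> F (h * x)%g = psi t u h * F x) ->
  (forall h x, Iw al n h -> F (x * h)%g = psi t u h * F x) ->
  ~ (exists s : k, [/\ s = 1 \/ s = -1, s * ent g 0 0 - 1 \in Pideal k al,
      s * ent g 1 1 - 1 \in Pideal k al & ent g 1 0 \in Pideal k n]) ->
  F g = 0.
Proof.
move=> al0 aln alnt u0 vu Fl Fr; apply: contra_notP => /eqP Fg.
apply: (psi_intertwiner pcharp p_odd w_unif PsiP al0 aln alnt u0 vu).
move=> x xI gI; apply: (mulIf Fg).
by rewrite -Fl// -Fr// -!mulgA mulVg mulg1.
Qed.

End EigenvectorExistence.

Section Eigenvectors.
Variable k : padicField.
Variables (w : k) (w_unif : uniformizer w).
Variables (C : numFieldType) (Psi : k -> C) (PsiP : depth_zero_character Psi).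
Variables (W : lmodType C) (sigma : representation (SL2R k) W).
Implicit Types x y g h : SL2R k.

Notation psi := (psi w Psi).

Lemma psi_congr al t u u' h : u - u' \in Pideal k 1 -> Iw al t h -> psi t u h = psi t u' h.
Proof.
move=> uu [_ _ hc]; apply: (Psi_congr PsiP).
have -> : w ^ (- t) * u * ent h 1 0 - w ^ (- t) * u' * ent h 1 0 =
  w ^ (- t) * (u - u') * ent h 1 0 by ring.
apply: (PidealM_le (PidealM (unif_expP w_unif (- t)) uu) hc).
by rewrite addrC addrA subrr add0r.
Qed.

(** Conjugating by diag(a, 1/a) multiplies the lower left entry by a square, so [u] matters only up
    to unit squares. *)
Lemma torus_eigenvector t u (a : k) v : 1 <= t -> a != 0 -> pval a = 0 ->
  eigenvector sigma (Iw 1 t) (psi t u) v ->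
  exists2 v', eigenvector sigma (Iw 1 t) (psi t (u * a ^+ 2)) v' & (v != 0 -> v' != 0).
Proof.
move=> t1 a0 va vP; have [aI aVI] := Pideal_unit a0 va.
have e : a * a^-1 - 0 * 0 = 1 by rewrite divff// mul0r subr0.
have E := mkKE e aI (Pideal0 k 0) (Pideal0 k 0) aVI.
set T := mkK a 0 0 a^-1 in E; exists (sigma T v); last first.
  by apply: contra_neq => /(congr1 (sigma T^-1%g)); rewrite repr_invK linear0.
move=> h [h0 h1 hc]; pose g := (T^-1 * h * T)%g.
have [g00 g11 g10] : [/\ ent g 0 0 = ent h 0 0, ent g 1 1 = ent h 1 1 &
    ent g 1 0 = a ^+ 2 * ent h 1 0].
  by split; rewrite !entM !entV !E !mxE/=; field.
have gI : Iw 1 t g.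
  split; rewrite ?g00 ?g11 ?g10//; apply: PidealMl => //.
  by rewrite expr2; exact: PidealMl.
have -> : sigma h (sigma T v) = sigma T (sigma g v).
  by rewrite -!reprM /g !mulgA mulgV mul1g.
rewrite vP// linearZ/=; congr (_ *: _); congr Psi; rewrite g10; ring.
Qed.

Variables (p : nat) (pcharp : p \in [pchar (residue_field k)]) (p_odd : odd p).
Variable N : nat.
Hypothesis N_triv : forall v, fixed_vector sigma (Kcong N) v.

Section Coefficient.
Variables (al n t : int) (u : k).
Hypotheses (al_gt0 : 1 <= al) (al_n : al <= n) (al_n_t : al + n = t + 1) (t_N : t + 1 <= N).
Hypotheses (u0 : u != 0) (vu : pval u = 0).

Let nN : n <= N. Proof. by ilia. Qed.
Let alN : al <= N. Proof. by ilia. Qed.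
Let uI : u \in Pideal k 0. Proof. by have [] := Pideal_unit u0 vu. Qed.
Let subH : is_subgroup (@Iw k al n). Proof. exact: Iw_subgroup. Qed.
Let NH : @Kcong k N `<=` Iw al n. Proof. exact: Kcong_Iw. Qed.

Let psiM2 : {in Iw al n &, {morph psi t u : x y / (x * y)%g >-> x * y}}.
Proof. by move=> x y /set_mem xI /set_mem yI; apply: (psiM w_unif PsiP al_gt0 al_n). Qed.

Let psi_Kcong x : Kcong N x -> psi t u x = 1.
Proof.
move=> [_ _ xc _]; apply: (psi_small w_unif PsiP uI).
exact: Pideal_le xc.
Qed.

(** Averaging a functional that is 1 at [v] makes the coefficient g |-> L(sigma g v) equivariant on
    both sides, so [psi_support] confines it to ± [Iw al n]. *)
Lemma psi_coefficient v : v != 0 -> eigenvector sigma (Iw al n) (psi t u) v ->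
  exists L : {linear W -> C^o},
  [/\ forall h (x : W), Iw al n h -> L (sigma h x) = psi t u h * L x, L v != 0 &
    forall g, ~ (exists s : k, [/\ s = 1 \/ s = -1, s * ent g 0 0 - 1 \in Pideal k al,
      s * ent g 1 1 - 1 \in Pideal k al & ent g 1 0 \in Pideal k n]) ->
    L (sigma g v) = 0].
Proof.
move=> v0 vP; have [l lv] := linear_functional v0.
have [m [s sP]] := Kcong_finite_index w_unif (@Iw k al n) N.
have subN := Kcong_subgroup k N.
pose L0 := average_functional (psi t u) s sigma l.
pose L : {linear W -> C^o} := HB.pack L0
  (GRing.isLinear.Build C W C^o _ L0 (average_functional_linear _ _ _ _)).
have LE : forall h (x : W), Iw al n h -> L (sigma h x) = psi t u h * L x.
  move=> h x Hh; apply: (average_functional_equivariant subH subN NH sP) => // y.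
  exact: psi_neq0.
exists L; split => //.
  have -> : L v = m%:R * l v.
    apply: (average_functional_eigen subH subN sP) => // y.
    exact: psi_neq0.
  rewrite lv mulr1 pnatr_eq0; have [_ _ _ sE] := sP.
  have [H1 _ _] := subH; have [i _] := sE _ H1.
  by rewrite -lt0n (leq_ltn_trans _ (ltn_ord i)).
move=> g; apply: (psi_support w_unif PsiP pcharp p_odd al_gt0 al_n al_n_t u0 vu
    (F := fun g => L (sigma g v))).
- by move=> h x Hh; rewrite reprM LE.
- by move=> h x Hh; rewrite reprM vP// 2!linearZ.
Qed.

(** The new vector is the projection of [v] at level (be, m). Under [L] only the representatives
    lying in [Iw al n] survive, and each contributes [L v], so nothing cancels. *)
Lemma level_change v : v != 0 -> eigenvector sigma (Iw al n) (psi t u) v ->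
  forall be m, 1 <= be -> be <= m -> be + m = t + 1 -> al <= be ->
  exists2 v', v' != 0 & eigenvector sigma (Iw be m) (psi t u) v'.
Proof.
move=> v0 vP be m be1 bem bemt albe.
have [L [LE Lv Lsupp]] := psi_coefficient v0 vP.
have [q [s sP]] := Kcong_finite_index w_unif (@Iw k be m) N.
have subN := Kcong_subgroup k N.
have subB : is_subgroup (@Iw k be m) by exact: Iw_subgroup.
have NB : @Kcong k N `<=` Iw be m by apply: Kcong_Iw; ilia.
exists (average (psi t u) s sigma v); last first.
  move=> h Hh; apply: (average_equivariant subB subN NB sP) => //.
  - move=> x y /set_mem xI /set_mem yI; exact: (psiM w_unif PsiP be1 bem).
  - by move=> x; exact: psi_neq0.
suff : L (average (psi t u) s sigma v) != 0.
  by apply: contra_neq => ->; rewrite linear0.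
have [sH _ _ _] := sP.
rewrite /average linear_sum/= (bigID (fun i => `[< Iw al n (s i) >]))/=.
rewrite [X in _ + X]big1 ?addr0; last first.
  move=> i /asboolPn si; rewrite linearZ.
  suff -> : L (sigma (s i) v) = 0 by exact: mulr0.
  apply: Lsupp => -[e [eE h0 h1 hc]].
  apply: si; have [s0 s1 sc] := sH i.
  (* The sign -1 would put 2 in P^al, since the diagonal of [s i] is already 1 modulo P^be and
     [al <= be]. *)
  case: eE h0 h1 => ->; first by rewrite !mul1r => h0 h1; split.
  rewrite mulN1r => h0 _; exfalso; have [two0 vtwo] := two_unit pcharp p_odd.
  have : - (- ent (s i) 0 0 - 1 + (ent (s i) 0 0 - 1)) \in Pideal k al.
    by apply: PidealN; apply: PidealD => //; exact: Pideal_le s0.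
  rewrite [X in X \in _](_ : _ = 2); last by ring.
  by rewrite PidealE// vtwo => h; move: (le_trans al_gt0 h); rewrite ler10.
rewrite (eq_bigr (fun=> L v)); last first.
  move=> i /asboolP si; rewrite linearZ LE//.
  exact: (mulKf (psi_neq0 _ PsiP _ _ _)).
rewrite sumr_const -[_ *+ _]mulr_natl mulf_eq0 negb_or Lv andbT pnatr_eq0 -lt0n.
apply: (count_coset_reps_gt0 _ subN sP) => //.
by have [] := subB.
Qed.

End Coefficient.
End Eigenvectors.

(** * Elementary divisors *)

Lemma nilpotent_eigenvector (k : padicField) (p : nat)
    (pcharp : p \in [pchar (residue_field k)]) (p_odd : odd p)
    (w : k) (w_unif : uniformizer w) (eps : k) (eps_nonsq : standard_nonsquare eps)
    (C : numFieldType) (Psi : k -> C) (PsiP : depth_zero_character Psi)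
    (W : lmodType C) (sigma : representation (SL2R k) W) (m : nat) (v : W) :
  (forall v', fixed_vector sigma (Kcong 1) v' -> v' = 0) ->
  v != 0 -> fixed_vector sigma (Iw 1 m) v ->
  exists (t : nat) (u : k) (v' : W), [/\ (0 < t)%N, u = 1 \/ u = eps, v' != 0 &
    eigenvector sigma (Iw 1 t) (psi w Psi t u) v'].
Proof.
move=> noK v0 vm.
pose Q (m : nat) := `[< exists2 v : W, v != 0 & fixed_vector sigma (Iw 1 m) v >].
have Qex : exists m, Q m by exists m; apply/asboolP; exists v.
case: (ex_minnP Qex) => q /asboolP[v1 v10 v1fix] qmin.
(* For q <= 1 the group [Iw 1 q] contains [Kcong 1], which fixes no nonzero vector. *)
have q2 : (1 < q)%N.
  rewrite ltnNge; apply/negP => q1; move: v10; rewrite (noK v1) ?eqxx// => h hK.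
  by apply: v1fix; apply: Kcong_Iw hK => //; rewrite lez_nat.
case: q q2 v1fix qmin => // t t0 v1fix qmin.
have t1 : 1 <= t%:Z by rewrite lez_nat.
have tS : (t.+1 : int) = t%:Z + 1 by rewrite -addn1 PoszD.
rewrite tS in v1fix.
have [b [v2 [bI v20 v2P]]] := exists_psi_eigenvector w_unif PsiP t1 v10 v1fix.
(* If [b] were in P, then [psi t b] would be trivial on [Iw 1 t], against the minimality of t +
   1. *)
have bN : b \notin Pideal k 1.
  apply/negP => b1; have := qmin t; rewrite ltnn => /implyP; rewrite implybF => /negP[].
  apply/asboolP; exists v2 => // h hI; rewrite v2P//.
  have b0 : b - 0 \in Pideal k 1 by rewrite subr0.
  rewrite (psi_congr w_unif PsiP b0 hI) /psi mulr0 mul0r (Psi0 PsiP).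
  exact: scale1r.
have [a [a0 va aE]] := unit_square_class pcharp p_odd eps_nonsq bI bN.
have [v3 v3P v30] := torus_eigenvector t1 a0 va v2P.
exists t; case: aE => aE; [exists 1, v3|exists eps, v3].
  split; [by []|by left|exact: v30|move=> h hI].
  by rewrite v3P// (psi_congr w_unif PsiP aE hI).
split; [by []|by right|exact: v30|move=> h hI].
by rewrite v3P// (psi_congr w_unif PsiP aE hI).
Qed.

Section ElementaryDivisors.
Variables (k : padicField) (w : k) (w_unif : uniformizer w) (n : int).
Implicit Types g : SL2 k.

(** The part of G_{c0,0+} inside K lies in the conjugate of G_{n,0+} by kap g. Geometrically, [kap]
    moves the vertex g n of the tree to the vertex c0 of the standard apartment. *)
Let conj_ok g (kap : SL2R k) (c0 : int) := forall h : SL2R k,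
  ent h 0 0 - 1 \in Pideal k 1 -> ent h 1 1 - 1 \in Pideal k 1 ->
  ent h 0 1 \in Pideal k (1 - c0) -> ent h 1 0 \in Pideal k (1 + c0) ->
  congr_set 1 (1 - n) (1 + n) ((\val kap * g)^-1 * \val h * (\val kap * g))%g.

(** Here g is diag(A, 1/A) times the upper unipotent with entry B / A in P^(-n). The unipotent fixes
    the vertex n and the torus shifts it by -2 val A. *)
Lemma conj_ok_upper g : \val g 1 0 = 0 -> \val g 0 0 != 0 ->
  \val g 0 1 / \val g 0 0 \in Pideal k (- n) ->
  conj_ok g 1%g (n - 2 * pval (\val g 0 0)).
Proof.
move=> g10 A0 BA h h00 h11 h01 h10; rewrite val1 mul1g.
have := SL2_detE g; rewrite g10 mulr0 subr0.
move: A0 BA h10 h01; set A := \val g 0 0; set B := \val g 0 1; set D := \val g 1 1.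
rewrite -/(ent h 0 0) => A0 BA h10 h01 AD.
have DE : D = A^-1 by rewrite -[RHS]mulr1 -AD mulKf.
have AI := Pideal_val A.
have AVI : A^-1 \in Pideal k (- pval A) by rewrite -pvalV ?Pideal_val.
have BI : B \in Pideal k (pval A - n) by rewrite addrC -Pideal_divr.
have hE i j : \val (\val h) i j = ent h i j by [].
split; rewrite !SL2_mulE SL2_invE !mxE/= !hE ?g10 -?/A -/B -/D ?DE.
- have -> : (A^-1 * ent h 0 0 + - B * ent h 1 0) * A + (A^-1 * ent h 0 1 + - B * ent h 1 1) * 0 - 1
    = (ent h 0 0 - 1) - B * ent h 1 0 * A by field.
  apply: PidealB => //; apply: (PidealM_le (PidealM BI h10) AI); lia.
- have -> : (A^-1 * ent h 0 0 + - B * ent h 1 0) * B + (A^-1 * ent h 0 1 + - B * ent h 1 1) * A^-1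
    = (ent h 0 0 - 1) * (B / A) - B * ent h 1 0 * B + A^-1 * ent h 0 1 * A^-1
      - (ent h 1 1 - 1) * (B / A) by field.
  apply: PidealB; last exact: PidealM.
  apply: PidealD; last by apply: (PidealM_le (PidealM AVI h01) AVI); lia.
  apply: PidealB; first exact: PidealM.
  by apply: (PidealM_le (PidealM BI h10) BI); lia.
- have -> : (- 0 * ent h 0 0 + A * ent h 1 0) * A + (- 0 * ent h 0 1 + A * ent h 1 1) * 0
    = A * ent h 1 0 * A by ring.
  by apply: (PidealM_le (PidealM AI h10) AI); lia.
- have -> : (- 0 * ent h 0 0 + A * ent h 1 0) * B + (- 0 * ent h 0 1 + A * ent h 1 1) * A^-1 - 1
    = A * ent h 1 0 * B + (ent h 1 1 - 1) by field.
  by apply: PidealD => //; apply: (PidealM_le (PidealM AI h10) BI); lia.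
Qed.

(** Here g is an antidiagonal matrix times the lower unipotent with entry A / B in P^n. The
    unipotent fixes the vertex n, and the antidiagonal factor reflects n to -n before shifting. *)
Lemma conj_ok_anti g : \val g 1 1 = 0 -> \val g 0 1 != 0 ->
  \val g 0 0 / \val g 0 1 \in Pideal k n ->
  conj_ok g 1%g (- n - 2 * pval (\val g 0 1)).
Proof.
move=> g11 B0 AB h h00 h11 h01 h10; rewrite val1 mul1g.
have := SL2_detE g; rewrite g11 mulr0 sub0r.
move: B0 AB h10 h01; set A := \val g 0 0; set B := \val g 0 1; set D := \val g 1 0.
move=> B0 AB h10 h01 BD.
have DE : D = - B^-1 by apply: (mulfI B0); rewrite mulrN divff// -BD opprK.
have BI := Pideal_val B.
have BVI : B^-1 \in Pideal k (- pval B) by rewrite -pvalV ?Pideal_val.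
have AI : A \in Pideal k (n + pval B) by rewrite -Pideal_divr.
have hE i j : \val (\val h) i j = ent h i j by [].
split; rewrite !SL2_mulE SL2_invE !mxE/= !hE ?g11 -?/A -/B -/D ?DE.
- have -> : (0 * ent h 0 0 + - B * ent h 1 0) * A + (0 * ent h 0 1 + - B * ent h 1 1) * - B^-1 - 1
    = (ent h 1 1 - 1) - B * ent h 1 0 * A by field.
  apply: PidealB => //; apply: (PidealM_le (PidealM BI h10) AI); lia.
- have -> : (0 * ent h 0 0 + - B * ent h 1 0) * B + (0 * ent h 0 1 + - B * ent h 1 1) * 0
    = - (B * ent h 1 0 * B) by ring.
  by apply: PidealN; apply: (PidealM_le (PidealM BI h10) BI); lia.
- have -> : (- - B^-1 * ent h 0 0 + A * ent h 1 0) * A + (- - B^-1 * ent h 0 1 + A * ent h 1 1) * - B^-1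
    = (ent h 0 0 - 1) * (A / B) + A * ent h 1 0 * A - B^-1 * ent h 0 1 * B^-1
      - (ent h 1 1 - 1) * (A / B) by field.
  apply: PidealB; last exact: PidealM.
  apply: PidealB; last by apply: (PidealM_le (PidealM BVI h01) BVI); lia.
  apply: PidealD; first exact: PidealM.
  by apply: (PidealM_le (PidealM AI h10) AI); lia.
- have -> : (- - B^-1 * ent h 0 0 + A * ent h 1 0) * B + (- - B^-1 * ent h 0 1 + A * ent h 1 1) * 0 - 1
    = A * ent h 1 0 * B + (ent h 0 0 - 1) by field.
  by apply: PidealD => //; apply: (PidealM_le (PidealM AI h10) BI); lia.
Qed.

(** The columns of g diag(1, w^n) span the lattice of the vertex g n. An entry of least valuation
    serves as pivot. *)
Let M g (i j : 'I_2) := \val g i j * (if j == 0 then 1 else w ^ n).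

Let conj_ok_mul g (kap kap' : SL2R k) c0 :
  conj_ok (\val kap' * g)%g kap c0 -> conj_ok g (kap * kap')%g c0.
Proof. by move=> ok; rewrite /conj_ok valM -[(_ * _ * g)%g]mulgA. Qed.

Lemma conj_ok_row0 g j : M g 0 j != 0 ->
  (forall i' j', M g i' j' / M g 0 j \in Pideal k 0) ->
  exists (kap : SL2R k) (c0 : int), 0 <= c0 /\ conj_ok g kap c0.
Proof.
have w0 := unif_exp_neq0 w_unif n; have wv := pval_unif_exp w_unif n.
have D := SL2_detE g.
have wM x : x * w ^ n \in Pideal k 0 = (x \in Pideal k (- n)).
  by rewrite -[x in RHS](mulfK w0) Pideal_divr// wv addNr.
have wD x y : x / (y * w ^ n) \in Pideal k 0 = (x / y \in Pideal k n).
  by rewrite invfM mulrA Pideal_divr// wv add0r.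
have lowE (c : k) (cI : c \in Pideal k 0) : forall i j, ent (mkK 1 0 c 1) i j = mx2 1 0 c 1 i j.
  by apply: mkKE; rewrite ?Pideal_one ?Pideal0//; ring.
move: j; apply: forall_ord2; rewrite /M /=; rewrite ?eqxx ?mulr1.
- move=> A0 min.
  have CA : \val g 1 0 / \val g 0 0 \in Pideal k 0 by have := min 1 0; rewrite mulr1.
  have BA : \val g 0 1 / \val g 0 0 \in Pideal k (- n).
    by have := min 0 1; rewrite mulrAC wM.
  have DA : \val g 1 1 / \val g 0 0 \in Pideal k (- n).
    by have := min 1 1; rewrite mulrAC wM.
  have E := lowE _ (PidealN CA).
  pose kap := mkK 1 0 (- (\val g 1 0 / \val g 0 0)) 1 : SL2R k.
  pose g' := (\val kap * g)%g.
  have g00 : \val g' 0 0 = \val g 0 0.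
    by rewrite SL2_mulE -!/(ent kap _ _) !E !mxE/=; ring.
  have g01 : \val g' 0 1 = \val g 0 1.
    by rewrite SL2_mulE -!/(ent kap _ _) !E !mxE/=; ring.
  have g10 : \val g' 1 0 = 0.
    by rewrite SL2_mulE -!/(ent kap _ _) !E !mxE/=; field.
  exists (1 * kap)%g, (n - 2 * pval (\val g 0 0)); split; last first.
    apply: conj_ok_mul; rewrite -/g' -g00; apply: conj_ok_upper => //; rewrite ?g00 ?g01//.
  (* Dividing det g = 1 by A^2 expresses A^-2 through ratios to the pivot, which gives 2 val A <= n,
     that is, c0 >= 0. The other column is treated alike. *)
  have AA : (\val g 0 0)^-1 / \val g 0 0 \in Pideal k (- n).
    have -> : (\val g 0 0)^-1 / \val g 0 0 = \val g 1 1 / \val g 0 0 -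
      (\val g 1 0 / \val g 0 0) * (\val g 0 1 / \val g 0 0).
      transitivity ((\val g 0 0 * \val g 1 1 - \val g 0 1 * \val g 1 0) / \val g 0 0 / \val g 0 0); last by field.
      by rewrite D mul1r.
    by apply: PidealB => //; exact: PidealMl.
  move: AA; rewrite -invfM PidealE ?invr_eq0 ?mulf_neq0// pvalV ?mulf_neq0// pvalM//.
  by lia.
- rewrite mulf_eq0 negb_or => /andP[B0 _] min.
  have DB : \val g 1 1 / \val g 0 1 \in Pideal k 0.
    have := min 1 1; rewrite -mulf_div divff// mulr1 //.
  have AB : \val g 0 0 / \val g 0 1 \in Pideal k n.
    by have := min 0 0; rewrite mulr1 wD.
  have CB : \val g 1 0 / \val g 0 1 \in Pideal k n.
    by have := min 1 0; rewrite mulr1 wD.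
  have E := lowE _ (PidealN DB).
  pose kap := mkK 1 0 (- (\val g 1 1 / \val g 0 1)) 1 : SL2R k.
  pose g' := (\val kap * g)%g.
  have g00 : \val g' 0 0 = \val g 0 0.
    by rewrite SL2_mulE -!/(ent kap _ _) !E !mxE/=; ring.
  have g01 : \val g' 0 1 = \val g 0 1.
    by rewrite SL2_mulE -!/(ent kap _ _) !E !mxE/=; ring.
  have g11 : \val g' 1 1 = 0.
    by rewrite SL2_mulE -!/(ent kap _ _) !E !mxE/=; field.
  exists (1 * kap)%g, (- n - 2 * pval (\val g 0 1)); split; last first.
    apply: conj_ok_mul; rewrite -/g' -g01; apply: conj_ok_anti => //; rewrite ?g00 ?g01//.
  have BB : (\val g 0 1)^-1 / \val g 0 1 \in Pideal k n.
    have -> : (\val g 0 1)^-1 / \val g 0 1 =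
      (\val g 1 1 / \val g 0 1) * (\val g 0 0 / \val g 0 1) - \val g 1 0 / \val g 0 1.
      transitivity ((\val g 0 0 * \val g 1 1 - \val g 0 1 * \val g 1 0) / \val g 0 1 / \val g 0 1); last by field.
      by rewrite D mul1r.
    by apply: PidealB => //; exact: PidealMl.
  move: BB; rewrite -invfM PidealE ?invr_eq0 ?mulf_neq0// pvalV ?mulf_neq0// pvalM//.
  by lia.
Qed.

Lemma conj_ok_exists g : exists (kap : SL2R k) (c0 : int), 0 <= c0 /\
  forall h : SL2R k,
  ent h 0 0 - 1 \in Pideal k 1 -> ent h 1 1 - 1 \in Pideal k 1 ->
  ent h 0 1 \in Pideal k (1 - c0) -> ent h 1 0 \in Pideal k (1 + c0) ->
  congr_set 1 (1 - n) (1 + n) ((\val kap * g)^-1 * \val h * (\val kap * g))%g.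
Proof.
have w0 := unif_exp_neq0 w_unif n.
have [ij0 ij0P] : exists ij : 'I_2 * 'I_2, M g ij.1 ij.2 != 0.
  have [g0|g0] := eqVneq (\val g 0 0) 0; last first.
    by exists (0, 0); rewrite /M /= mulr1.
  exists (0, 1); rewrite /M /= mulf_neq0//; apply: contraTneq isT => g1.
  by have := SL2_detE g; rewrite g0 g1 !mul0r subrr => /esym/eqP; rewrite oner_eq0.
have [[i j] /= Mij Mmin] := @Order.TotalTheory.arg_minP _ _ _ ij0
  (fun ij => M g ij.1 ij.2 != 0) (fun ij => pval (M g ij.1 ij.2)) ij0P.
have {}Mmin i' j' : M g i' j' / M g i j \in Pideal k 0.
  have [->|M0] := eqVneq (M g i' j') 0; first by rewrite mul0r Pideal0.
  by rewrite Pideal_divr// add0r PidealE//; exact: (Mmin (i', j')).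
move: i Mij Mmin; apply: forall_ord2 => Mij Mmin; first exact: conj_ok_row0 Mij Mmin.
(* A pivot in the second row is brought to the first by the Weyl element of K. *)
have e : 0 * 0 - 1 * -1 = 1 :> k by ring.
have E := mkKE e (Pideal0 k 0) (Pideal_one k) (PidealN (Pideal_one k)) (Pideal0 k 0).
set s := mkK 0 1 (-1) 0 in E.
have M0 j' : M (\val s * g)%g 0 j' = M g 1 j'.
  by rewrite /M SL2_mulE -!/(ent s _ _) !E !mxE/= mul0r mul1r add0r.
have M1 j' : M (\val s * g)%g 1 j' = - M g 0 j'.
  by rewrite /M SL2_mulE -!/(ent s _ _) !E !mxE/= mul0r mulN1r addr0 mulNr.
have [||kap [c0 [c00 ok]]] := @conj_ok_row0 (\val s * g)%g j.
- by rewrite M0.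
- rewrite M0; apply: forall_ord2 => j'; first by rewrite M0.
  by rewrite M1 mulNr; exact: PidealN.
by exists (kap * s)%g, c0; split => //; exact: conj_ok_mul.
Qed.

End ElementaryDivisors.

(** * Shalika's inducing data *)

Section ShalikaData.
Variables (R : realType) (k : padicField) (p : nat).
Hypotheses (pcharp : p \in [pchar (residue_field k)]) (p_odd : odd p).
Variables (w : k) (w_unif : uniformizer w).
Variables (Psi : k -> R[i]) (PsiP : depth_zero_character Psi).
Variables (theta : SL2 k -> R[i]).

Lemma ceil_half (t : nat) : Num.ceil (t%:~R / 2 : R) = (uphalf t)%:Z.
Proof.
apply: ceil_def; have -> : (t%:~R : R) = (odd t)%:R + 2 * (t./2)%:R.
  by rewrite -[LHS]/(t%:R) -[in LHS](odd_double_half t) natrD -mul2n natrM.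
rewrite uphalf_half PoszD intrD intrB intrD -[((t./2)%:Z)%:~R]/((t./2)%:R : R).
by case: (odd t) => /=; rewrite ?mulr1z ?mulr0z; apply/andP; split; lra.
Qed.

Lemma ceil_half_half (t : nat) : Num.ceil (t%:~R / 2 + 2^-1 : R) = (t./2.+1)%:Z.
Proof.
have -> : t%:~R / 2 + 2^-1 = (t.+1)%:~R / 2 :> R.
  by rewrite intS intrD mulr1z; lra.
by rewrite ceil_half.
Qed.

(** Over the segment, the upper right condition is strictest at x = 0 and the lower left one at x =
    1/2. *)
Lemma GsegE (t : nat) : Gseg k (t%:~R / 2 : R) =
  congr_set (uphalf t)%:Z (uphalf t)%:Z (t./2.+1)%:Z.
Proof.
have h2 : 0 <= 2^-1 :> R by rewrite invr_ge0 ler0n.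
apply/seteqP; split=> g.
  move=> h; have /= := h 0; have /= := h 2^-1; rewrite /= !in_itv/= !lexx h2.
  move=> /(_ isT)[_ _ + _] /(_ isT)[+ + _ +].
  by rewrite subr0 ceil_half ceil_half_half => ? ? ? ?; split.
move=> [g0 gb gc g1] x /=; rewrite in_itv/= => /andP[x0 x2].
split; rewrite ?ceil_half//.
  by apply: Pideal_le gb; rewrite -(ceil_half t) le_ceil// gerBl.
by apply: Pideal_le gc; rewrite -(ceil_half_half t) le_ceil// lerD2l.
Qed.

Definition sgnSL (s : k) : SL2 k := mkSL2 s 0 0 s.

Lemma sgnSLE s : s = 1 \/ s = -1 -> \val (sgnSL s) = mx2 s 0 0 s.
Proof. by move=> sE; apply: mkSL2E; case: sE => ->; ring. Qed.

Lemma sgn_val s n : s = 1 \/ s = -1 -> (s \in Pideal k 0) *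
  ((s - 1 \in Pideal k (n + 1) -> 0 <= n -> s = 1) * (s * s = 1)).
Proof.
have [two0 vtwo] := two_unit pcharp p_odd.
move=> sE; split; first by case: sE => ->; pid.
split; last by case: sE => ->; ring.
case: sE => -> //; rewrite -opprD => /PidealN; rewrite opprK (_ : 1 + 1 = 2); last by ring.
by rewrite PidealE// vtwo => h n0; exfalso; move: h; lia.
Qed.

(** Since 2 is a unit, a sign is determined modulo P; this makes the value of Shalika's character
    independent of the factorization. *)
Lemma sgn_uniq s s' x : s = 1 \/ s = -1 -> s' = 1 \/ s' = -1 ->
  s * x - 1 \in Pideal k 1 -> s' * x - 1 \in Pideal k 1 -> s = s'.
Proof.
have [two0 vtwo] := two_unit pcharp p_odd.
have two1 : (2 : k) \notin Pideal k 1 by rewrite PidealE// vtwo.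
move=> [->|->] [->|->] // h h'; exfalso; have := PidealN (PidealD h h').
  by rewrite [X in X \in _](_ : _ = 2) ?(negPf two1)//; ring.
by rewrite [X in X \in _](_ : _ = 2) ?(negPf two1)//; ring.
Qed.

Lemma antidiagE (u : k) : antidiag u 0 = mx2 0 u 0 0.
Proof. by apply/matrixP; apply: forall_ord2; apply: forall_ord2; rewrite !mxE. Qed.

Lemma mulmx2 (A B : 'M[k]_2) i j : (A *m B) i j = A i 0 * B 0 j + A i 1 * B 1 j.
Proof. by rewrite mxE sum_ord2. Qed.

Lemma centralizerP (u : k) (g : SL2 k) : u != 0 -> centralizerK (antidiag u 0) g ->
  exists s, [/\ s = 1 \/ s = -1, \val g = mx2 s (\val g 0 1) 0 s &
    \val g 0 1 \in Pideal k 0].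
Proof.
move=> u0 [/integral_SL2P gI /matrixP gX]; rewrite antidiagE in gX.
have g10 : \val g 1 0 = 0.
  have := gX 0 0; rewrite !mulmx2 !mxE/= !mulr0 mul0r !addr0 add0r => /esym/eqP.
  by rewrite mulf_eq0 (negPf u0) => /eqP.
have g11 : \val g 1 1 = \val g 0 0.
  have := gX 0 1; rewrite !mulmx2 !mxE/= mulr0 mul0r addr0 add0r mulrC.
  by move=> /(mulfI u0).
exists (\val g 0 0); split=> //.
  have := SL2_detE g; rewrite g10 g11 mulr0 subr0 -expr2 => /eqP.
  by rewrite sqrf_eq1 => /orP[/eqP|/eqP]; [left|right].
apply/matrixP; apply: forall_ord2; apply: forall_ord2; by rewrite [in RHS]mxE.
Qed.

Lemma prod_char_eq (gT : groupType) (A B : set gT) (phi psi : gT -> R[i]) a b :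
  A a -> B b ->
  (forall a' b', A a' -> B b' -> (a * b = a' * b')%g -> phi a' * psi b' = phi a * psi b) ->
  prod_char A B phi psi (a * b)%g = phi a * psi b.
Proof.
move=> Aa Bb uniq; rewrite /prod_char.
set S := [set y | _]; have : S (xget 0 S).
  by apply: (@xgetPex _ 0 S); exists (phi a * psi b), a, b.
by move=> [a' [b' [Aa' Bb' e ->]]]; exact: uniq.
Qed.

Lemma unip_extE (g : SL2 k) s : s = 1 \/ s = -1 -> \val g = mx2 s (\val g 0 1) 0 s ->
  \val g 0 1 \in Pideal k 0 -> unip_ext theta g = theta (sgnSL s).
Proof.
move=> sE gE gI; have [sI [_ ss]] := sgn_val 0 sE.
have [two0 _] := two_unit pcharp p_odd.
have e : 1 * 1 - s * \val g 0 1 * 0 = 1 :> k by ring.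
pose b := mkSL2 1 (s * \val g 0 1) 0 1.
have -> : g = (sgnSL s * b)%g.
  by apply: SL2_eqP; rewrite SL2_mulE sgnSLE// mkSL2E// gE !mxE/=;
    rewrite ?mulr0 ?mul0r ?mulr1 ?addr0 ?add0r ?mulrA ?ss ?mul1r.
have bU : upper_unipotent b.
  exists (s * \val g 0 1); first exact: PidealMl.
  rewrite mkSL2E// antidiagE.
  by apply/matrixP; apply: forall_ord2; apply: forall_ord2; rewrite !mxE/= ?addr0 ?add0r.
have zP s' : s' = 1 \/ s' = -1 -> SL2_center k (sgnSL s').
  move=> s'E; rewrite /SL2_center /= sgnSLE//.
  case: s'E => ->; [left|right];
  by apply/matrixP; apply: forall_ord2; apply: forall_ord2; rewrite !mxE/= ?mulr1n ?mulr0n ?oppr0.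
rewrite /unip_ext prod_char_eq ?mulr1//; first exact: zP.
move=> a b' aZ [y yI b'E] ab; rewrite mulr1; congr theta.
have [s' s'E aE] : exists2 s', s' = 1 \/ s' = -1 & a = sgnSL s'.
  case: aZ => aE; [exists 1; first by left|exists (-1); first by right].
    apply/val_inj; rewrite aE sgnSLE; last by left.
    by apply/matrixP; apply: forall_ord2; apply: forall_ord2; rewrite !mxE.
  apply/val_inj; rewrite aE sgnSLE; last by right.
  by apply/matrixP; apply: forall_ord2; apply: forall_ord2; rewrite !mxE/= ?mulr1n ?mulr0n ?oppr0.
rewrite aE; congr sgnSL; have := congr1 (fun x : SL2 k => \val x 0 0) ab.
rewrite !SL2_mulE aE !sgnSLE// b'E antidiagE mkSL2E// !mxE/=.
by rewrite ?mul0r ?addr0 ?mulr1 => ->.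
Qed.

Section Level.
Variables (t : nat) (u : k).
Hypotheses (t_gt0 : (0 < t)%N) (u0 : u != 0).

Let al : int := uphalf t.
Let n : int := t./2.+1.

Let al_gt0 : 1 <= al. Proof. by rewrite /al; lia. Qed.
Let al_n : al <= n. Proof. by rewrite /al /n; lia. Qed.

(** Explicit form of C(X) J: the unipotents of C(X) absorb the upper right condition of J, and the
    center contributes the sign [s]. *)
Definition signed_Iw (s : k) (g : SL2 k) :=
  [/\ s = 1 \/ s = -1, g \in @integral_SL2 k, s * \val g 0 0 - 1 \in Pideal k al,
    s * \val g 1 1 - 1 \in Pideal k al & \val g 1 0 \in Pideal k n].

Lemma signed_Iw_mul a b : centralizerK (antidiag u 0) a ->
  Gseg k (t%:~R / 2 : R) b -> signed_Iw (\val a 0 0) (a * b)%g.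
Proof.
move=> aC; rewrite GsegE => -[b0 bb bc b1].
have [s [sE aE aI]] := centralizerP u0 aC.
have [sI [_ ss]] := sgn_val 0 sE.
have a00 : \val a 0 0 = s by rewrite aE mxE.
have a10 : \val a 1 0 = 0 by rewrite aE mxE.
have a11 : \val a 1 1 = s by rewrite aE mxE.
have bI i j : \val b i j \in Pideal k 0.
  have h x : x - 1 \in Pideal k al -> x \in Pideal k 0.
    move=> x1; rewrite -(subrK 1 x); apply: PidealD; last exact: Pideal_one.
    by apply: Pideal_le x1; exact: le_trans al_gt0.
  move: i j; apply: forall_ord2; apply: forall_ord2; [exact: h|..|exact: h].
    by apply: Pideal_le bb.
  by apply: Pideal_le bc.
have aI' i j : \val a i j \in Pideal k 0 by have [/integral_SL2P] := aC.
rewrite a00; split => //.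
- apply/integral_SL2P => i j; rewrite SL2_mulE; apply: PidealD; exact: PidealMl.
- rewrite SL2_mulE a00 mulrDr mulrA ss mul1r addrAC; apply: PidealD => //.
  by apply: PidealMl => //; apply: PidealMl => //; apply: Pideal_le bc.
- by rewrite SL2_mulE a10 a11 mul0r add0r mulrA ss mul1r.
- by rewrite SL2_mulE a10 a11 mul0r add0r; apply: PidealMl.
Qed.

Lemma shalika_value a b : centralizerK (antidiag u 0) a ->
  unip_ext theta a * PsiX w Psi t (antidiag u 0) b =
  theta (sgnSL (\val a 0 0)) *
    Psi (w ^ (- (t : int)) * u * (\val a 0 0 * \val (a * b)%g 1 0)).
Proof.
move=> aC; have [s [sE aE aI]] := centralizerP u0 aC.
have [sI [_ ss]] := sgn_val 0 sE.
have a00 : \val a 0 0 = s by rewrite aE mxE.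
have a10 : \val a 1 0 = 0 by rewrite aE mxE.
have a11 : \val a 1 1 = s by rewrite aE mxE.
rewrite a00 (unip_extE sE)//; congr (_ * _); rewrite /PsiX; congr Psi.
rewrite SL2_mulE a10 a11 mul0r add0r [s * (s * _)]mulrA ss mul1r -mulrA; congr (_ * _).
rewrite /mxtrace sum_ord2 !mulmx2 antidiagE !mxE/= mulr0n !mul0r !addr0 add0r subr0.
by [].
Qed.

Lemma signed_Iw_decomp s g : signed_Iw s g -> exists a b,
  [/\ centralizerK (antidiag u 0) a, Gseg k (t%:~R / 2 : R) b & g = (a * b)%g].
Proof.
move=> [sE /integral_SL2P gI g0 g1 gc]; have [sI [_ ss]] := sgn_val 0 sE.
have s0 : s != 0 by apply: contraTneq (oner_neq0 k) => s0; rewrite -ss s0 mul0r eqxx.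
have [|q0 _ _ qVI] := Pideal_one_plus _ g1; first exact: lt_le_trans al_gt0.
(* Chosen so that the upper right entry of a^-1 g vanishes; [s * \val g 1 1] is in 1 + P, hence
   invertible in the ring of integers. *)
pose y := s * \val g 0 1 / (s * (s * \val g 1 1)).
have g110 : \val g 1 1 != 0 by apply: contraNneq q0 => ->; rewrite mulr0.
have yI : y \in Pideal k 0.
  rewrite /y invfM [s^-1](_ : _ = s); last by rewrite -[RHS]mulr1 -(divff s0) mulrA ss mul1r.
  by apply: PidealMl; [exact: PidealMl|exact: PidealMl].
have e : s * s - y * 0 = 1 by rewrite ss mulr0 subr0.
pose a := mkSL2 s y 0 s; have aE : \val a = mx2 s y 0 s by exact: mkSL2E.
exists a, (a^-1 * g)%g; split; last by rewrite mulgA mulgV mul1g.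
  split; first apply/integral_SL2P; rewrite aE.
    by apply: forall_ord2; apply: forall_ord2; rewrite mxE/= ?Pideal0.
  by apply/matrixP; apply: forall_ord2; apply: forall_ord2;
    rewrite !mulmx2 antidiagE !mxE/=; ring.
rewrite GsegE; split; rewrite SL2_mulE SL2_invE aE !mxE/=.
- rewrite (_ : _ - 1 = s * \val g 0 0 - 1 - y * \val g 1 0); last by ring.
  by apply: PidealB => //; apply: PidealMl => //; apply: Pideal_le gc.
- rewrite (_ : _ + _ = 0) ?Pideal0// /y mulrA ss mul1r mulNr divfK// mulrC subrr//.
- by rewrite oppr0 mul0r add0r; exact: PidealMl.
- by rewrite oppr0 mul0r add0r.
Qed.

Lemma shalika_groupP g :
  shalika_group R t (antidiag u 0) g <-> exists s, signed_Iw s g.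
Proof.
split=> [[a aC [b bJ /esym ab]]|[s /signed_Iw_decomp[a [b [aC bJ ->]]]]].
  by exists (\val a 0 0); rewrite ab; exact: signed_Iw_mul.
by exists a => //; exists b.
Qed.

Lemma shalika_charE s g : signed_Iw s g ->
  shalika_char w Psi t (unip_ext theta) (antidiag u 0) g =
  theta (sgnSL s) * Psi (w ^ (- (t : int)) * u * (s * \val g 1 0)).
Proof.
move=> sg.
have val_eq a b : centralizerK (antidiag u 0) a -> Gseg k (t%:~R / 2 : R) b ->
    g = (a * b)%g -> unip_ext theta a * PsiX w Psi t (antidiag u 0) b =
    theta (sgnSL s) * Psi (w ^ (- (t : int)) * u * (s * \val g 1 0)).
  move=> aC bJ ab; have := signed_Iw_mul aC bJ; rewrite -ab => -[s'E _ _ g1 _].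
  rewrite shalika_value// -ab; have [sE _ _ g1' _] := sg.
  by rewrite (sgn_uniq s'E sE (Pideal_le al_gt0 g1) (Pideal_le al_gt0 g1')).
have [a [b [aC bJ ab]]] := signed_Iw_decomp sg.
rewrite -(val_eq a b)// ab /shalika_char; apply: prod_char_eq => //.
by move=> a' b' aC' bJ' ab'; rewrite !val_eq// ab.
Qed.

Lemma shalika_group_subgroup :
  is_subgroup (\val @^-1` shalika_group R t (antidiag u 0) : set (SL2R k)).
Proof.
have P (x : SL2R k) : (\val @^-1` shalika_group R t (antidiag u 0) : set (SL2R k)) x <->
    exists s, signed_Iw s (\val x) by exact: shalika_groupP.
have valE (x : SL2R k) i j : \val (\val x) i j = ent x i j by [].
split.
- apply/P; exists 1; split; rewrite ?valE ?ent1/= ?mul1r ?subrr ?Pideal0//; first by left.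
  exact: (valP (1%g : SL2R k)).
- move=> x y /P[s [sE _ x0 x1 xc]] /P[s' [s'E _ y0 y1 yc]]; apply/P.
  have [sI [_ ss]] := sgn_val 0 sE; have [s'I [_ ss']] := sgn_val 0 s'E.
  exists (s * s'); rewrite !valE in x0 x1 xc y0 y1 yc.
  have xc' := Pideal_le al_n xc; have yc' := Pideal_le al_n yc.
  split; rewrite ?valE ?entM.
  + by case: sE => ->; case: s'E => ->; rewrite ?mul1r ?mulNr ?mul1r ?opprK; [left|right|right|left].
  + exact: valP.
  + have -> : s * s' * (ent x 0 0 * ent y 0 0 + ent x 0 1 * ent y 1 0) - 1 =
      s * ent x 0 0 * (s' * ent y 0 0 - 1) + (s * ent x 0 0 - 1)
        + s * s' * ent x 0 1 * ent y 1 0 by ring.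
    by pid.
  + have -> : s * s' * (ent x 1 0 * ent y 0 1 + ent x 1 1 * ent y 1 1) - 1 =
      s * ent x 1 1 * (s' * ent y 1 1 - 1) + (s * ent x 1 1 - 1)
        + s * s' * ent y 0 1 * ent x 1 0 by ring.
    by pid.
  + by pid.
- move=> x /P[s [sE _ x0 x1 xc]]; apply/P; exists s; split=> //; first exact: valP.
  + by rewrite valE entV mxE.
  + by rewrite valE entV mxE.
  + by rewrite valE entV mxE/=; exact: PidealN.
Qed.

End Level.
End ShalikaData.

(** * Identification of [sigma] and conclusion *)

Lemma isomorphic_shalika (R : realType) (k : padicField) (p : nat)
    (pcharp : p \in [pchar (residue_field k)]) (p_odd : odd p)
    (w : k) (w_unif : uniformizer w) (Psi : k -> R[i]) (PsiP : depth_zero_character Psi)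
    (theta : SL2 k -> R[i]) (W : lmodType R[i]) (sigma : representation (SL2R k) W)
    (t : nat) (u : k) (v : W) (N : nat) :
  (0 < t)%N -> u != 0 -> pval u = 0 ->
  irreducible sigma -> (forall v, fixed_vector sigma (Kcong N) v) ->
  (forall s x, s = 1 \/ s = -1 -> \val x = sgnSL s ->
    forall v, sigma x v = theta (sgnSL s) *: v) ->
  v != 0 -> eigenvector sigma (Iw 1 t) (psi w Psi t u) v ->
  isomorphic sigma (shalika w Psi t (unip_ext theta) (antidiag u 0)).
Proof.
move=> t0 u0 vu irr N_triv0 center v0 vP.
pose al : int := uphalf t; pose n : int := t./2.+1.
have al1 : 1 <= al by rewrite /al; lia.
have aln : al <= n by rewrite /al /n; lia.
have alnt : al + n = t%:Z + 1 by rewrite /al /n; lia.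
have t1 : 1 <= t%:Z by lia.
(* Large enough for [Kcong M] to act trivially on [sigma], to lie in both [Iw 1 t] and [Iw al n],
   and to be killed by [psi t u]. *)
pose M := (N + t.+1)%N.
have tM : t%:Z + 1 <= M by rewrite /M; lia.
have alM : al <= M by rewrite /M /al; lia.
have nM : n <= M by rewrite /M /n; lia.
have MN : (N : int) <= M by rewrite /M; lia.
have N_triv x : fixed_vector sigma (Kcong M) x.
  by move=> g /(Kcong_mono MN); exact: N_triv0.
have t11 : 1 + t%:Z = t%:Z + 1 by rewrite addrC.
have [vH vH0 vHP] := level_change w_unif PsiP pcharp p_odd N_triv (lexx 1) t1 t11 tM u0 vu
  v0 vP al1 aln alnt al1.
have [L [LE Lv Lsupp]] := psi_coefficient w_unif PsiP pcharp p_odd N_triv al1 aln alnt tM u0 vu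
  vH0 vHP.
have [q [s sP]] := Kcong_finite_index w_unif setT M.
pose H := (\val @^-1` shalika_group R t (antidiag u 0) : set (SL2R k)).
have HP x : H x <-> exists s, signed_Iw t s (\val x).
  exact: (shalika_groupP R pcharp p_odd t0 u0).
rewrite /shalika.
apply: (irreducible_isomorphic_induced (L := L) (w := vH) (Kcong_subgroup k M) sP).
- exact: (shalika_group_subgroup R pcharp p_odd t0 u0).
- move=> x xM; apply/HP; exists 1; have [x0 x1 xc] := Kcong_Iw alM nM xM.
  by split; rewrite ?mul1r//; [left|exact: valP].
- by [].
- by [].
- move=> h x /HP[e [eE hI h0 h1 hc]].
  rewrite [(_ \o _) h](shalika_charE pcharp p_odd w Psi theta t0 u0 (s := e)); last by split.
  have [eI [_ ee]] := sgn_val pcharp p_odd 0 eE.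
  have E : forall i j, ent (mkK e 0 0 e) i j = mx2 e 0 0 e i j.
    by apply: mkKE; rewrite ?Pideal0// mulr0 subr0.
  set z := mkK e 0 0 e in E.
  have zE : \val z = sgnSL e.
    by apply: SL2_eqP; rewrite -/(ent z _ _) E sgnSLE.
  have zz : (z * z = 1)%g.
    by apply: SL2R_eqP; rewrite entM !E ent1 !mxE/= ?mulr0 ?mul0r ?addr0 ?add0r ?ee.
  (* Removing the central sign puts [h] in [Iw al n]; the sign acts through [theta]. *)
  pose j := (z * h)%g.
  have jE i' j' : ent j i' j' = e * ent h i' j'.
    by move: i' j'; apply: forall_ord2 => j'; rewrite entM !E !mxE/= mul0r ?addr0 ?add0r.
  have jI : Iw al n j.
    by split; rewrite jE//; exact: PidealMl.
  have -> : sigma h x = theta (sgnSL e) *: sigma j x.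
    by rewrite -(center _ z eE zE) -reprM /j mulgA zz mul1g.
  rewrite linearZ LE// /psi jE.
  by rewrite -[LHS]/(_ * (_ * _)) mulrA.
- exact: Lv.
- move=> g gH; apply: Lsupp => -[e [eE g0 g1 gc]]; apply: gH; apply/HP; exists e.
  by split => //; exact: valP.
Qed.

Theorem mainTheorem2 (R : realType) (k : padicField)
    (p : nat) (pcharp : p \in [pchar (residue_field k)]) (p_odd : odd p)
    (w : k) (w_unif : uniformizer w)
    (eps : k) (eps_nonsq : standard_nonsquare eps)
    (Psi : k -> R[i]) (PsiP : depth_zero_character Psi)
    (V : lmodType R[i]) (pi : representation (SL2 k) V)
    (pi_smooth : smooth pi) (pi_irr : irreducible pi) (pi_depth : has_depth pi 0)
    (theta : SL2 k -> R[i]) (thetaP : central_character pi theta)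
    (W : lmodType R[i]) (sigma : representation (SL2R k) W)
    (sigma_irr : irreducible sigma)
    (sigma_comp : subrepresentation sigma (restriction (SL2R k) pi))
    (d : R) (d_gt0 : 0 < d) (sigma_depth : has_depthK sigma d) :
  exists2 t : int, 1 <= t &
    isomorphic sigma (shalika w Psi t (unip_ext theta) (antidiag 1 0)) \/
    isomorphic sigma (shalika w Psi t (unip_ext theta) (antidiag eps 0)).
Proof.
have [f f_inj f_int] := sigma_comp.
have [[_ [x [v0 v00 v0fix]]] _] := pi_depth.
(* G_{n,0+} is contained in G_{x,0+}, so the point [x] may be replaced by the vertex [n]. *)
pose n := Num.floor x.
have noK v' : fixed_vector sigma (Kcong 1) v' -> v' = 0.
  move=> v'fix; apply/eqP; apply: contraTT d_gt0 => v'0; rewrite -leNgt.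
  have [_] := sigma_depth; apply; split=> //; exists v' => // h hK; apply: v'fix.
  by move: hK; rewrite /Gxrp /ceil_plus subr0 addr0 floor0 add0r.
have subgK (i : nat) := Kcong_subgroup k i.
have normK (i : nat) := @Kcong_normal k i.
have monoK (i j : nat) : (i <= j)%N -> @Kcong k j `<=` Kcong i.
  by move=> ij; apply: Kcong_mono; rewrite lez_nat.
have smoothK v : exists i : nat, fixed_vector (restriction (SL2R k) pi) (Kcong i) v.
  have [r r0 vr] := pi_smooth v; exists (absz (Num.ceil r)) => h [h0 hb hc h1].
  have ri : Num.ceil r <= absz (Num.ceil r) by rewrite abszE ler_norm.
  by apply: vr; split; rewrite ?subr0 ?addr0; apply: (Pideal_le ri).
have [g [w1 w10 w1fix]] := transfer_fixed_vector f_inj f_int subgK normK monoK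
  (fun i => Kcong_finite_index w_unif setT i) smoothK pi_irr sigma_irr v00.
have v0fix' h : congr_set 1 (1 - n) (1 + n) h -> pi h v0 = v0.
  move=> [h0 hb hc h1]; apply: v0fix; split; rewrite /ceil_plus ?floor0 ?add0r//.
    apply: Pideal_le hb; rewrite addrC lerD2l.
    by rewrite -(ler_int R) (le_trans (ge_floor _))// rmorphN lerN2 ge_floor.
  by rewrite addrC.
have [kap [c0 [c00 kapP]]] := conj_ok_exists w_unif n g.
pose v := sigma kap w1.
have v_neq0 : v != 0.
  by apply: contra_neq w10 => /(congr1 (sigma kap^-1%g)); rewrite repr_invK linear0.
have vfix h : ent h 0 0 - 1 \in Pideal k 1 -> ent h 1 1 - 1 \in Pideal k 1 ->
    ent h 0 1 \in Pideal k (1 - c0) -> ent h 1 0 \in Pideal k (1 + c0) -> sigma h v = v.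
  move=> h0 h1 hb hc; have hv := v0fix' _ (kapP h h0 h1 hb hc).
  have hw : sigma (kap^-1 * h * kap)%g w1 = w1.
    apply: w1fix; rewrite -reprM -[in RHS]hv -reprM; congr (pi _ v0).
    by rewrite !valM gmulfV invgM !mulgA mulgV mul1g.
  by rewrite /v -[in RHS]hw -!reprM !mulgA mulgV mul1g.
(* At c0 = 0 the vector [v] would be fixed by [Kcong 1]. From c0 >= 1 on, the condition on the upper
   right entry is automatic in K, and the fixing group contains [Iw 1 (1 + c0)]. *)
have c01 : 1 <= c0.
  have : c0 != 0; last by move: c00; lia.
  apply: contra_neq v_neq0 => c0E; apply: noK => h [h0 hb hc h1].
  by apply: vfix; rewrite ?c0E ?subr0 ?addr0.
have [|t [u [v1 [t0 uE v10 v1P]]]] := nilpotent_eigenvector pcharp p_odd w_unif eps_nonsq PsiP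
    (m := absz (1 + c0)) noK v_neq0.
  move=> h [h0 h1 hc]; apply: vfix => //.
    apply: Pideal_le (ent_int _ _ _); lia.
  by apply: Pideal_le hc; lia.
have [i0 i0P] := smoothK (f v).
have Ntriv : forall v, fixed_vector sigma (Kcong i0) v.
  apply: (irreducible_normal_fixed sigma_irr (normK i0) v_neq0) => h hK.
  by apply: f_inj; rewrite f_int; exact: i0P.
have center s (y : SL2R k) : s = 1 \/ s = -1 -> \val y = sgnSL s ->
    forall v, sigma y v = theta (sgnSL s) *: v.
  move=> sE yE z; apply: f_inj; rewrite f_int linearZ /= yE.
  have [_ h] := thetaP; apply: h; rewrite /SL2_center /= sgnSLE//.
  by case: sE => ->; [left|right]; apply/matrixP; apply: forall_ord2; apply: forall_ord2;
    rewrite !mxE/= ?mulr1n ?mulr0n ?oppr0.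
have [e0 ve _ _] := eps_nonsq.
exists (t : int); first by lia.
case: uE => uE; [left|right]; rewrite uE in v1P.
  exact: (isomorphic_shalika pcharp p_odd w_unif PsiP t0 (oner_neq0 k) (pval1 k)
    sigma_irr Ntriv center v10 v1P).
exact: (isomorphic_shalika pcharp p_odd w_unif PsiP t0 e0 ve sigma_irr Ntriv center v10 v1P).
Qed.
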